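(* Let $n>1$ and assume $\lambda\neq 0$. The normalized representations $R_{a,b,c,M,N,\alpha}$ of $\mathfrak g$ are non-isomorphic to each other (that is, distinct data $(a,b,c,M,N,\alpha)$ with $M,N$ normalized give non-isomorphic representations). Moreover, a normalized representation $R_{a,b,c,M,N,\alpha}$ is relatively faithful, except only when it is of extreme type.
   Context: $F$ is an algebraically closed field of characteristic $0$; all Lie algebras and representations are finite dimensional over $F$. $M_{p\times q}$ is the space of $p\times q$ matrices over $F$, and $\mathfrak{gl}(d)$ is the Lie algebra of $d\times d$ matrices over $F$. The Lie algebra $\mathfrak g$. Let $V$ be an $F$-vector space of dimension $n>1$ with basis $v_0,\dots,v_{n-1}$. $L(V)=V\oplus\Lambda^2(V)$ is the free 2-step nilpotent Lie algebra: $[v,w]=v\wedge w$ and $[u,v\wedge w]=0$ for $u,v,w\in V$ (and $[\Lambda^2(V),\Lambda^2(V)]=0$). Then $\mathfrak g=\langle x\rangle\ltimes L(V)$, where $x$ acts on $V$ by $[x,v_i]=\lambda v_i+v_{i+1}$ for $0\le i\le n-2$ and $[x,v_{n-1}]=\lambda v_{n-1}$ ($\lambda\in F$), and on $\Lambda^2(V)$ by $[x,v\wedge w]=[x,v]\wedge w+v\wedge[x,w]$. A uniserial representation is one whose module has a unique composition series. A uniserial representation $R$ of $\mathfrak g$ is relatively faithful if $\ker(R)\cap\Lambda^2(V)$ is properly contained in $\Lambda^2(V)$ and $\ker(R)\cap V=(0)$. The representations $R_{a,b,c,M,N,\alpha}$. Let $(a,b,c)$ be positive integers with ($a+b=n+1$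 and $c\le a$) or ($c+b=n+1$ and $a\le c$); let $M\in M_{a\times b}$, $N\in M_{b\times c}$ with $M_{a,1}\ne0$, $N_{b,1}\neq0$; let $\alpha\in F$. With $J^p(\beta)$ the upper triangular Jordan block of size $p$ and eigenvalue $\beta$, the (uniserial) representation $R=R_{a,b,c,M,N,\alpha}:\mathfrak g\to\mathfrak{gl}(d)$, $d=a+b+c$, is given in block form (block sizes $a,b,c$) by $$R(x)=A=\begin{pmatrix}J^a(\alpha)&0&0\\0&J^b(\alpha-\lambda)&0\\0&0&J^c(\alpha-2\lambda)\end{pmatrix},$$ $$R(v_k)=(\mathrm{ad}_{\mathfrak{gl}(d)}A-\lambda 1_{\mathfrak{gl}(d)})^k\begin{pmatrix}0&M&0\\0&0&N\\0&0&0\end{pmatrix},\quad 0\le k\le n-1,$$ $$R(v\wedge w)=[R(v),R(w)],\quad v,w\in V.$$ $M$ and $N$ (and then $R$) are called normalized if the last rows of $M$ and $N$ are equal to the first canonical vectors of $F^b$ and $F^c$, respectively, and the first column of $M$ is equal to the last canonical vector of $F^a$. A normalized $R$ is of extreme type if $n$ is odd, $a=1$, $c=1$ and $N_{i,1}=0$ for all even $i$. *)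

(* Defs.v *)
From HB Require Import structures.
From mathcomp Require Import all_boot all_order all_algebra ring.
Set Implicit Arguments.
Unset Strict Implicit.
Unset Printing Implicit Defensive.
Import GRing.Theory.
Local Open Scope ring_scope.

HB.mixin Record Vector_isLieAlgebra (F : fieldType) L of Vector F L := {
  lie_bracket : L -> L -> L;
  lie_bracketPl : forall (a : F) (y1 y2 z : L),
    lie_bracket (a *: y1 + y2) z = a *: lie_bracket y1 z + lie_bracket y2 z;
  lie_bracketPr : forall (a : F) (y z1 z2 : L),
    lie_bracket y (a *: z1 + z2) = a *: lie_bracket y z1 + lie_bracket y z2;
  lie_bracket_alt : forall y : L, lie_bracket y y = 0;
  lie_jacobi : forall y z t : L,
    lie_bracket y (lie_bracket z t) + lie_bracket z (lie_bracket t y)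
      + lie_bracket t (lie_bracket y z) = 0
}.

#[short(type="lieAlgType")]
HB.structure Definition LieAlgebra (F : fieldType) :=
  {L of Vector F L & Vector_isLieAlgebra F L}.

Definition commutator (F : fieldType) (d : nat) (X Y : 'M[F]_d) : 'M[F]_d :=
  X *m Y - Y *m X.

(* Matrices act on column vectors: the module of [rho] is ['cV[F]_d]. *)
Record lieRep (F : fieldType) (L : lieAlgType F) (d : nat) := LieRep {
  rep_fun :> {linear L -> 'M[F]_d};
  rep_bracket : forall y z : L,
    rep_fun (lie_bracket y z) = commutator (rep_fun y) (rep_fun z)
}.

Section Representations.
Variables (F : fieldType) (L : lieAlgType F).

Definition rep_iso (d d' : nat) (rho : lieRep L d) (rho' : lieRep L d') : Prop :=
  exists2 f : {linear 'cV[F]_d -> 'cV[F]_d'}, bijective f &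
    forall (y : L) (u : 'cV[F]_d), f (rho y *m u) = rho' y *m f u.

Definition proper_vs (vT : vectType F) (U W : {vspace vT}) : bool :=
  (U <= W)%VS && (U != W).

Variables (d : nat) (rho : lieRep L d).

Definition submodule (U : {vspace 'cV[F]_d}) : Prop :=
  forall (y : L) (u : 'cV[F]_d), u \in U -> rho y *m u \in U.

Definition simple_quotient (U W : {vspace 'cV[F]_d}) : Prop :=
  [/\ submodule U, submodule W, proper_vs U W &
      forall X, submodule X -> (U <= X)%VS -> (X <= W)%VS -> X = U \/ X = W].

(* The series is [0 :: s]; its first term is left implicit. *)
Definition composition_series (s : seq {vspace 'cV[F]_d}) : Prop :=
  last 0%VS s = fullv /\
  forall i, (i < size s)%N ->
    simple_quotient (nth 0%VS (0%VS :: s) i) (nth 0%VS s i).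

Definition uniserial : Prop := exists! s, composition_series s.

Definition rep_ker : {vspace L} := lker (linfun rho).

End Representations.

Section ExteriorSquare.
Variables (F : fieldType) (n : nat).

Definition lt_pair := {p : 'I_n * 'I_n | (p.1 < p.2)%N}.

(* Coordinates with respect to the basis v_i /\ v_j, i < j, where v_i is the
   i-th vector of the standard basis of 'rV[F]_n. *)
Definition ext2 := {ffun lt_pair -> F^o}.
HB.instance Definition _ := Vector.on ext2.

Definition wedge (u w : 'rV[F]_n) : ext2 :=
  [ffun p : lt_pair => u 0 (val p).1 * w 0 (val p).2 - u 0 (val p).2 * w 0 (val p).1].

Definition bvec (i : 'I_n) : 'rV[F]_n := delta_mx 0 i.

(* Linear extension to Lambda^2(V) of v_i /\ v_j |-> f i j, i < j. *)
Definition ext2_lift (W : lmodType F) (f : 'I_n -> 'I_n -> W) (q : ext2) : W :=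
  \sum_(p : lt_pair) (q p : F) *: f (val p).1 (val p).2.

End ExteriorSquare.

Definition jordan (F : fieldType) (p : nat) (beta : F) : 'M[F]_p :=
  \matrix_(i, j) (beta *+ (i == j) + ((i.+1 == j)%N)%:R).

(* [(s, (u, q))] stands for s x + u + q with u in V and q in Lambda^2(V). The
   carrier does not depend on [lambda], but the bracket [g_bracket] does. *)
Definition gLie (F : fieldType) (n : nat) (lambda : F) : Type :=
  (F^o * ('rV[F]_n * ext2 F n))%type.
HB.instance Definition _ (F : fieldType) (n : nat) (lambda : F) :=
  Vector.on (gLie n lambda).

Section TheLieAlgebra.
Variables (F : fieldType) (n : nat) (lambda : F).

(* [bvec i *m jordan n lambda] is [lambda *: bvec i + bvec i.+1], the last
   summand being absent when [i.+1 = n]: see [adxVE]. *)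
Definition adxV (u : 'rV[F]_n) : 'rV[F]_n := u *m jordan n lambda.

Definition adxL2 : ext2 F n -> ext2 F n :=
  ext2_lift (fun i j => wedge (adxV (bvec F i)) (bvec F j)
                        + wedge (bvec F i) (adxV (bvec F j))).

Local Notation gT := (gLie n lambda).

Definition g_bracket (y z : gT) : gT :=
  let: (s, (u, q)) := y in let: (t, (w, r)) := z in
  (0, ((s : F) *: adxV w - (t : F) *: adxV u,
       wedge u w + ((s : F) *: adxL2 r - (t : F) *: adxL2 q))).

Definition g_x : gT := (1, (0, 0)).
Definition g_V (u : 'rV[F]_n) : gT := (0, (u, 0)).
Definition g_L2 (q : ext2 F n) : gT := (0, (0, q)).

Lemma g_linE (a s t : F) (u w : 'rV[F]_n) (q r : ext2 F n) :
  a *: ((s, (u, q)) : gT) + ((t, (w, r)) : gT) =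
  (a * s + t, (a *: u + w, a *: q + r)) :> gT.
Proof. by []. Qed.

Lemma g_addE (s t : F) (u w : 'rV[F]_n) (q r : ext2 F n) :
  ((s, (u, q)) : gT) + ((t, (w, r)) : gT) = (s + t, (u + w, q + r)) :> gT.
Proof. by []. Qed.

Lemma g_oppE (s : F) (u : 'rV[F]_n) (q : ext2 F n) :
  - ((s, (u, q)) : gT) = (- s, (- u, - q)) :> gT.
Proof. by []. Qed.

Lemma g_V_linear : linear g_V.
Proof. by move=> a u w; rewrite /g_V g_linE mulr0 scaler0 !addr0. Qed.
HB.instance Definition _ := GRing.isLinear.Build F 'rV[F]_n gT _ g_V g_V_linear.

Lemma g_L2_linear : linear g_L2.
Proof. by move=> a u w; rewrite /g_L2 g_linE mulr0 scaler0 !addr0. Qed.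
HB.instance Definition _ := GRing.isLinear.Build F (ext2 F n) gT _ g_L2 g_L2_linear.

Definition subV : {vspace gT} := limg (linfun g_V).
Definition subL2 : {vspace gT} := limg (linfun g_L2).

Lemma adxVE (i : 'I_n) : adxV (bvec F i) =
  lambda *: bvec F i + (if insub i.+1 is Some j then bvec F j else 0).
Proof.
apply/rowP=> k; rewrite /adxV /bvec -rowE !mxE eqxx /= mulr_natr.
case: insubP => [j _ jE|]; rewrite ?mxE.
  by rewrite eqxx -jE /= eq_sym; congr (_ + _%:R); rewrite -val_eqE /= eq_sym.
rewrite -leqNgt => le_n; rewrite [k == i]eq_sym; congr (_ + _).
case: (i.+1 =P k) => // kE; have := ltn_ord k; rewrite -kE => lt_n.
by have := leq_trans lt_n le_n; rewrite ltnn.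
Qed.

Lemma adxV_linear : linear adxV.
Proof. by move=> a u w; rewrite /adxV mulmxDl scalemxAl. Qed.

Lemma wedgePl a (u1 u2 w : 'rV[F]_n) :
  wedge (a *: u1 + u2) w = a *: wedge u1 w + wedge u2 w.
Proof.
apply/ffunP=> p; rewrite !ffunE !mxE /= /GRing.scale /= !mulrDl !mulrDr !mulrA.
by rewrite mulrN !mulrA opprD addrACA.
Qed.

Lemma wedgePr a (u w1 w2 : 'rV[F]_n) :
  wedge u (a *: w1 + w2) = a *: wedge u w1 + wedge u w2.
Proof.
apply/ffunP=> p; rewrite !ffunE !mxE /= /GRing.scale /= !mulrDr.
by rewrite mulrN opprD addrACA !mulrA ![u 0 _ * a]mulrC.
Qed.

Lemma wedge_alt (u : 'rV[F]_n) : wedge u u = 0.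
Proof. by apply/ffunP=> p; rewrite !ffunE [X in _ - X]mulrC subrr. Qed.

Lemma wedgeC (u w : 'rV[F]_n) : wedge u w = - wedge w u.
Proof.
by apply/ffunP=> p; rewrite !ffunE opprB addrC ![u 0 _ * _]mulrC; rewrite addrC.
Qed.

Lemma ext2_lift_linear (W : lmodType F) (f : 'I_n -> 'I_n -> W) :
  linear (ext2_lift f).
Proof.
move=> a q r; rewrite /ext2_lift scaler_sumr -big_split; apply: eq_bigr => p _ /=.
by rewrite !ffunE scalerDl scalerA.
Qed.

Lemma ext2_lift_wedge (W : lmodType F) (f : 'I_n -> 'I_n -> W) u w :
    (forall i, f i i = 0) -> (forall i j, f i j = - f j i) ->
  ext2_lift f (wedge u w) = \sum_i \sum_j (u 0 i * w 0 j) *: f i j.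
Proof.
move=> f0 fC.
pose G (p : 'I_n * 'I_n) := (u 0 p.1 * w 0 p.2) *: f p.1 p.2.
transitivity (\sum_(p : 'I_n * 'I_n) G p); last by rewrite pair_bigA.
rewrite (bigID (fun p : 'I_n * 'I_n => (p.1 < p.2)%N)) /=.
rewrite [X in _ = _ + X](_ : _ = \sum_(p : 'I_n * 'I_n | (p.1 < p.2)%N) G (p.2, p.1)).
  rewrite -big_split /= /ext2_lift.
  transitivity (\sum_(p : lt_pair n) (G (val p) + G ((val p).2, (val p).1))).
    apply: eq_bigr => p _; rewrite ffunE /G /= (fC (val p).2) scalerN -scalerBl.
    by [].
  exact: esym (big_sub (fun p : 'I_n * 'I_n => (p.1 < p.2)%N) (fun p => G p + G (p.2, p.1))).
pose sw (p : 'I_n * 'I_n) := (p.2, p.1).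
have swK : involutive sw by case.
rewrite (reindex_inj (inv_inj swK)) /= (bigID (fun p : 'I_n * 'I_n => p.1 == p.2)) /=.
rewrite big1 ?add0r => [|[i j] /= /andP[_ /eqP ->]]; last by rewrite /G /= f0 scaler0.
by apply: eq_bigl => -[i j] /=; rewrite -leqNgt -val_eqE /= andbC -ltn_neqAle.
Qed.

Lemma bilin_basis (W : lmodType F) (f : 'rV[F]_n -> 'rV[F]_n -> W) :
    (forall a u1 u2 w, f (a *: u1 + u2) w = a *: f u1 w + f u2 w) ->
    (forall a u w1 w2, f u (a *: w1 + w2) = a *: f u w1 + f u w2) ->
  forall u w, f u w = \sum_i \sum_j (u 0 i * w 0 j) *: f (bvec F i) (bvec F j).
Proof.
move=> fl fr u w.
have su (v : 'rV[F]_n) : v = \sum_i v 0 i *: bvec F i by exact: row_sum_delta.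
pose g : {linear 'rV[F]_n -> W} :=
  HB.pack (f^~ w) (GRing.isLinear.Build F _ _ _ (f^~ w) (fun a x y => fl a x y w)).
have -> : f u w = g u by [].
rewrite {1}[u]su linear_sum; apply: eq_bigr => i _; rewrite linearZ /=.
pose h : {linear 'rV[F]_n -> W} :=
  HB.pack (f (bvec F i)) (GRing.isLinear.Build F _ _ _ (f (bvec F i)) (fun a x y => fr a _ x y)).
have -> : f (bvec F i) w = h w by [].
rewrite {1}[w]su linear_sum scaler_sumr; apply: eq_bigr => j _.
by rewrite linearZ /= scalerA.
Qed.

Lemma lift_bilin (W : lmodType F) (f : 'rV[F]_n -> 'rV[F]_n -> W) :
    (forall a u1 u2 w, f (a *: u1 + u2) w = a *: f u1 w + f u2 w) ->
    (forall a u w1 w2, f u (a *: w1 + w2) = a *: f u w1 + f u w2) ->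
    (forall u, f u u = 0) ->
  forall u w, ext2_lift (fun i j => f (bvec F i) (bvec F j)) (wedge u w) = f u w.
Proof.
move=> fl fr f0 u w; rewrite ext2_lift_wedge -?bilin_basis // => i j.
apply/eqP; rewrite -addr_eq0; apply/eqP; set x := bvec F i; set y := bvec F j.
have frD u1 : f u1 (x + y) = f u1 x + f u1 y.
  by have := fr 1 u1 x y; rewrite !scale1r.
have := fl 1 x y (x + y); rewrite !scale1r f0 !frD !f0 add0r addr0.
by move<-.
Qed.

Lemma ext2_span (q : ext2 F n) :
  q = ext2_lift (fun i j => wedge (bvec F i) (bvec F j)) q.
Proof.
apply/ffunP=> p; rewrite /ext2_lift sum_ffunE (bigD1 p) //= big1 => [|p' ne].
  have e12 : ((val p).1 == (val p).2) = false by apply: ltn_eqF; exact: (valP p).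
  rewrite !ffunE !mxE !eqxx /= e12 [_ == (val p).1]eq_sym e12 mul0r subr0 mul1r.
  by rewrite addr0; exact: esym (mulr1 _).
rewrite !ffunE !mxE !eqxx /= -!natrM !mulnb.
case: p p' ne => -[i j] /= ij [[i' j'] /= ij'] ne.
have /negPf-> : ~~ ((i == i') && (j == j')).
  by apply: contra ne => /andP[/eqP e1 /eqP e2]; rewrite -val_eqE /= e1 e2.
have /negPf-> : ~~ ((j == i') && (i == j')).
  apply/negP=> /andP[/eqP e1 /eqP e2]; move: (ij) (ij'); rewrite /= e1 e2 => ij1 ij2.
  by have := ltn_trans ij1 ij2; rewrite ltnn.
by rewrite subr0; apply: mulr0.
Qed.

Lemma adxL2_wedge (u w : 'rV[F]_n) :
  adxL2 (wedge u w) = wedge (adxV u) w + wedge u (adxV w).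
Proof.
rewrite /adxL2 (@lift_bilin _ (fun u w => wedge (adxV u) w + wedge u (adxV w))) //.
- by move=> a u1 u2 w1; rewrite adxV_linear !wedgePl scalerDr addrACA.
- by move=> a u1 w1 w2; rewrite adxV_linear !wedgePr scalerDr addrACA.
- by move=> u1; rewrite [wedge u1 _]wedgeC subrr.
Qed.

Lemma adxL2_linear : linear adxL2.
Proof. exact: ext2_lift_linear. Qed.

HB.instance Definition _ := GRing.isLinear.Build F _ _ _ adxV adxV_linear.
HB.instance Definition _ := GRing.isLinear.Build F _ _ _ adxL2 adxL2_linear.
HB.instance Definition _ u :=
  GRing.isLinear.Build F _ _ _ (wedge u) (fun a => wedgePr a u).

Lemma g_bracketPr (a : F) (y z1 z2 : gT) :
  g_bracket y (a *: z1 + z2) = a *: g_bracket y z1 + g_bracket y z2.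
Proof.
case: y z1 z2 => s [u q] [t [w r]] [t' [w' r']].
rewrite g_linE /g_bracket g_linE mulr0 addr0; congr (_, (_, _)).
  rewrite adxV_linear scalerDr [a *: (_ - _)]scalerBr !scalerA scalerDl opprD.
  by rewrite addrACA [s * a]mulrC.
rewrite wedgePr adxL2_linear !scalerDr scalerN !scalerA scalerDl opprD.
by rewrite [s * a]mulrC -[RHS]addrACA; congr (_ + _); rewrite addrACA.
Qed.

Lemma g_bracketC (y z : gT) : g_bracket y z = - g_bracket z y.
Proof.
case: y z => s [u q] [t [w r]]; rewrite /g_bracket.
rewrite g_oppE oppr0 !opprD !opprK; congr (_, (_, _)); first by rewrite addrC.
by rewrite -wedgeC [X in _ = _ + X]addrC.
Qed.

Lemma g_bracketPl (a : F) (y1 y2 z : gT) :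
  g_bracket (a *: y1 + y2) z = a *: g_bracket y1 z + g_bracket y2 z.
Proof. by rewrite g_bracketC g_bracketPr opprD -scalerN -!(g_bracketC _ z). Qed.

Lemma g_bracket_alt (y : gT) : g_bracket y y = 0.
Proof. by case: y => s [u q]; rewrite /g_bracket wedge_alt !subrr addr0. Qed.

Lemma g_bracket3 (s1 s2 s3 : F) (u1 u2 u3 : 'rV[F]_n) (q1 q2 q3 : ext2 F n) :
  g_bracket (s1, (u1, q1)) (g_bracket (s2, (u2, q2)) (s3, (u3, q3))) =
  (0, (s1 *: (s2 *: adxV (adxV u3) - s3 *: adxV (adxV u2)),
       s2 *: wedge u1 (adxV u3) - s3 *: wedge u1 (adxV u2)
       + s1 *: (wedge (adxV u2) u3 + wedge u2 (adxV u3)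
                + (s2 *: adxL2 (adxL2 q3) - s3 *: adxL2 (adxL2 q2))))).
Proof.
rewrite /g_bracket !scale0r !subr0; congr (_, (_, _ + _)).
- by rewrite [adxV (_ - _)]linearB /= ![adxV (_ *: _)]linearZ.
- by rewrite [wedge u1 (_ - _)]linearB /= ![wedge u1 (_ *: _)]linearZ.
rewrite [adxL2 (_ + _)]linearD /= [adxL2 (_ - _)]linearB /=.
by rewrite ![adxL2 (_ *: _)]linearZ adxL2_wedge.
Qed.

Lemma g_jacobi (y z t : gT) :
  g_bracket y (g_bracket z t) + g_bracket z (g_bracket t y)
    + g_bracket t (g_bracket y z) = 0.
Proof.
have keyV (W : lmodType F) (s1 s2 s3 : F) (A B C : W) :
  s1 *: (s2 *: C - s3 *: B) + s2 *: (s3 *: A - s1 *: C) + s3 *: (s1 *: B - s2 *: A) = 0.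
  rewrite !scalerBr !scalerA [s2 * s1]mulrC [s3 * s1]mulrC [s3 * s2]mulrC.
  by rewrite [X in X + _]addrC !addrA !subrK subrr.
have keyF (s1 s2 s3 a12 a13 a23 a21 a31 a32 q1 q2 q3 : F) :
  s2 * a13 - s3 * a12 + s1 * (- a32 + a23 + (s2 * q3 - s3 * q2)) +
  (s3 * a21 - s1 * a23 + s2 * (- a13 + a31 + (s3 * q1 - s1 * q3))) +
  (s1 * a32 - s2 * a31 + s3 * (- a21 + a12 + (s1 * q2 - s2 * q1))) = 0 by ring.
case: y z t => s1 [u1 q1] [s2 [u2 q2]] [s3 [u3 q3]].
rewrite !g_bracket3 !g_addE !addr0.
rewrite [wedge (adxV u2) _]wedgeC [wedge (adxV u3) _]wedgeC [wedge (adxV u1) _]wedgeC.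
congr (_, (_, _)); first exact: keyV.
move: (wedge u1 _) (wedge u1 _) (wedge u2 _) (wedge u2 _) (wedge u3 _) (wedge u3 _).
move: (adxL2 _) (adxL2 _) (adxL2 _) => Q1 Q2 Q3 a b c d e f.
apply/ffunP=> p; rewrite !ffunE; exact: keyF.
Qed.

HB.instance Definition _ := Vector_isLieAlgebra.Build F gT
  g_bracketPl g_bracketPr g_bracket_alt g_jacobi.

End TheLieAlgebra.

Definition ord_first (p : nat) (p_gt0 : (0 < p)%N) : 'I_p := Ordinal p_gt0.
Definition ord_last (p : nat) (p_gt0 : (0 < p)%N) : 'I_p := rev_ord (ord_first p_gt0).

(* All proof fields are boolean equations, hence proof irrelevant: two data are
   equal if and only if they have the same (a, b, c, M, N, alpha). *)
Record rep_data (F : fieldType) (n : nat) := RepData {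
  dim_a : nat;
  dim_b : nat;
  dim_c : nat;
  dim_a_gt0 : (0 < dim_a)%N;
  dim_b_gt0 : (0 < dim_b)%N;
  dim_c_gt0 : (0 < dim_c)%N;
  dim_cond : ((dim_a + dim_b == n.+1) && (dim_c <= dim_a)
              || (dim_c + dim_b == n.+1) && (dim_a <= dim_c))%N;
  mx_M : 'M[F]_(dim_a, dim_b);
  mx_N : 'M[F]_(dim_b, dim_c);
  mx_M_neq0 : mx_M (ord_last dim_a_gt0) (ord_first dim_b_gt0) != 0;
  mx_N_neq0 : mx_N (ord_last dim_b_gt0) (ord_first dim_c_gt0) != 0;
  eig : F
}.

Section Blocks.
Variables (F : fieldType) (a b c : nat).
Implicit Types (M : 'M[F]_(a, b)) (N : 'M[F]_(b, c)).

Definition diag_blocks (X : 'M[F]_a) (Y : 'M[F]_b) (Z : 'M[F]_c) : 'M[F]_(a + b + c) :=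
  block_mx (block_mx X 0 0 Y) 0 0 Z.

Definition upper_blocks M N : 'M[F]_(a + b + c) :=
  block_mx (block_mx 0 M 0 0) (col_mx 0 N) 0 0.

Definition corner_block (Y : 'M[F]_(a, c)) : 'M[F]_(a + b + c) :=
  block_mx 0 (col_mx Y 0) 0 0.

Lemma diag_upper X Y Z M N :
  diag_blocks X Y Z *m upper_blocks M N = upper_blocks (X *m M) (Y *m N).
Proof.
rewrite /diag_blocks /upper_blocks !mulmx_block mul_block_col.
by rewrite !mulmx0 !mul0mx !addr0 !add0r.
Qed.

Lemma upper_diag X Y Z M N :
  upper_blocks M N *m diag_blocks X Y Z = upper_blocks (M *m Y) (N *m Z).
Proof.
rewrite /diag_blocks /upper_blocks !mulmx_block.
by rewrite !mulmx0 !mul0mx !addr0 !add0r mul_col_mx mul0mx.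
Qed.

Lemma upper_upper M N M' N' :
  upper_blocks M N *m upper_blocks M' N' = corner_block (M *m N').
Proof.
rewrite /corner_block /upper_blocks !mulmx_block mul_block_col.
by rewrite !mulmx0 !mul0mx !addr0 !add0r block_mx0.
Qed.

Lemma corner_upper Y M N : corner_block Y *m upper_blocks M N = 0.
Proof.
rewrite /corner_block /upper_blocks !mulmx_block.
by rewrite !mulmx0 !mul0mx !addr0 block_mx0.
Qed.

Lemma upper_corner Y M N : upper_blocks M N *m corner_block Y = 0.
Proof.
rewrite /corner_block /upper_blocks !mulmx_block mul_block_col.
by rewrite !mulmx0 !mul0mx !addr0 col_mx0 block_mx0.
Qed.

Lemma corner_corner Y Y' : corner_block Y *m corner_block Y' = 0.
Proof.
rewrite /corner_block !mulmx_block.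
by rewrite !mulmx0 !mul0mx !addr0 block_mx0.
Qed.

Lemma upper_lin k M N M' N' :
  upper_blocks (k *: M + M') (k *: N + N') = k *: upper_blocks M N + upper_blocks M' N'.
Proof.
rewrite /upper_blocks !scale_block_mx !add_block_mx scale_col_mx add_col_mx.
by rewrite !scaler0 !addr0.
Qed.

Lemma upper0 : upper_blocks 0 0 = 0.
Proof. by rewrite /upper_blocks col_mx0 !block_mx0. Qed.

Lemma corner_lin k Y Y' :
  corner_block (k *: Y + Y') = k *: corner_block Y + corner_block Y'.
Proof.
rewrite /corner_block !scale_block_mx !add_block_mx scale_col_mx add_col_mx.
by rewrite !scaler0 !addr0.
Qed.

Lemma corner0 : corner_block 0 = 0.
Proof. by rewrite /corner_block col_mx0 !block_mx0. Qed.

End Blocks.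

Section Commutators.
Variables (F : fieldType) (d : nat).
Implicit Types X Y Z : 'M[F]_d.

Lemma commutatorPr X : linear (commutator X).
Proof.
move=> k Y Z; rewrite /commutator mulmxDr mulmxDl -scalemxAr -scalemxAl.
by rewrite scalerBr opprD addrACA.
Qed.
HB.instance Definition _ X := GRing.isLinear.Build F _ _ _ (commutator X) (commutatorPr X).

Lemma commutatorC X Y : commutator X Y = - commutator Y X.
Proof. by rewrite /commutator opprB. Qed.

Lemma commutatorPl k X Y Z :
  commutator (k *: X + Y) Z = k *: commutator X Z + commutator Y Z.
Proof. by rewrite commutatorC commutatorPr opprD -scalerN -!(commutatorC _ Z). Qed.

Lemma commutator_alt X : commutator X X = 0.
Proof. exact: subrr. Qed.

Lemma commutator_der X Y Z :
  commutator X (commutator Y Z) = commutator (commutator X Y) Z + commutator Y (commutator X Z).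
Proof.
rewrite /commutator !(mulmxBl, mulmxBr) !mulmxA.
move: (X *m Y *m Z) (X *m Z *m Y) (Y *m Z *m X) (Z *m Y *m X) (Y *m X *m Z) (Z *m X *m Y).
by move=> x1 x2 x3 x4 x5 x6; apply/matrixP=> i j; rewrite !mxE; ring.
Qed.

End Commutators.

Section Shift.
Variables (F : fieldType) (p q : nat).

Definition shift_mx (X : 'M[F]_(p, q)) : 'M[F]_(p, q) := jordan p 0 *m X - X *m jordan q 0.

Lemma jordanE r (beta : F) : jordan r beta = beta%:M + jordan r 0.
Proof. by apply/matrixP=> i j; rewrite !mxE mul0rn add0r. Qed.

Lemma shift_iter (X : 'M[F]_(p, q)) k (i : 'I_p) (j : 'I_q) :
  (p + j < k + i.+1)%N -> iter k shift_mx X i j = 0.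
Proof.
elim: k i j => [|k IHk] i j lt_k.
  have := ltn_ord i; rewrite ltnNge -ltnS.
  by rewrite (leq_trans _ lt_k) // ltnS leq_addr.
rewrite iterS; set Z := iter k _ X in IHk *.
rewrite /shift_mx !mxE !big1 ?subr0 // => l _; rewrite !mxE mul0rn add0r.
  case: (l.+1 =P j) => [lE|]; last by rewrite mulr0.
  by rewrite IHk ?mul0r // -ltnS -addnS lE -addSn addSn.
case: (i.+1 =P l) => [lE|]; last by rewrite mul0r.
by rewrite IHk ?mulr0 // -lE addnS -addSn.
Qed.

Lemma shift_nil (X : 'M[F]_(p, q)) k : (p + q <= k.+1)%N -> iter k shift_mx X = 0.
Proof.
move=> le_k; apply/matrixP=> i j; rewrite shift_iter ?mxE //.
rewrite addnS ltnS; apply: leq_trans (leq_addr _ _).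
by rewrite -ltnS (leq_trans _ le_k) // -addnS leq_add2l.
Qed.

End Shift.

Section TheRepresentation.
Variables (F : fieldType) (n : nat) (lambda : F) (D : rep_data F n).

Notation a := (dim_a D).
Notation b := (dim_b D).
Notation c := (dim_c D).

Definition rep_dim : nat := a + b + c.

Definition R_x : 'M[F]_rep_dim :=
  diag_blocks (jordan a (eig D)) (jordan b (eig D - lambda))
              (jordan c (eig D - lambda *+ 2)).

Definition R_v (k : nat) : 'M[F]_rep_dim :=
  iter k (fun X => commutator R_x X - lambda *: X) (upper_blocks (mx_M D) (mx_N D)).

Definition R_V (u : 'rV[F]_n) : 'M[F]_rep_dim := \sum_(k < n) u 0 k *: R_v k.

Definition R_L2 : ext2 F n -> 'M[F]_rep_dim :=
  ext2_lift (fun i j => commutator (R_v i) (R_v j)).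

Definition R_fun (y : gLie n lambda) : 'M[F]_rep_dim :=
  let: (s, (u, q)) := y in (s : F) *: R_x + R_V u + R_L2 q.

Lemma R_vE k : R_v k = upper_blocks (iter k (@shift_mx F _ _) (mx_M D))
                                    (iter k (@shift_mx F _ _) (mx_N D)).
Proof.
rewrite /R_v; elim: k => //= k ->; set M := iter k _ _; set N := iter k _ _.
rewrite /commutator diag_upper upper_diag.
have uB X X' Y Y' : upper_blocks X Y - upper_blocks X' Y' =
    upper_blocks (X - X') (Y - Y') :> 'M[F]_rep_dim.
  by rewrite -[X - X']addrC -[Y - Y']addrC -!scaleN1r upper_lin addrC.
have uZ z X Y : z *: upper_blocks X Y = upper_blocks (z *: X) (z *: Y) :> 'M[F]_rep_dim.
  by rewrite -[z *: X]addr0 -[z *: Y]addr0 upper_lin upper0 addr0.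
have step p q (X : 'M[F]_(p, q)) x :
    jordan p x *m X - X *m jordan q (x - lambda) - lambda *: X = shift_mx X.
  rewrite (jordanE _ x) (jordanE _ (x - _)) /shift_mx mulmxDl mulmxDr.
  rewrite mul_scalar_mx mul_mx_scalar.
  move: (jordan p 0 *m X) (X *m jordan q 0) => Y Z.
  by apply/matrixP=> i j; rewrite !mxE; ring.
rewrite uZ !uB; congr upper_blocks; first exact: step.
by rewrite mulr2n opprD addrA step.
Qed.

Lemma R_v_nil : R_v n = 0.
Proof.
have [le1 le2] : (a + b <= n.+1)%N /\ (b + c <= n.+1)%N.
  case/orP: (dim_cond D) => /andP[/eqP <- le_ac]; split=> //.
  - by rewrite addnC leq_add2r.
  - by rewrite leq_add2r.
  by rewrite addnC.
by rewrite R_vE !shift_nil // upper0.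
Qed.

Lemma R_v_step k : commutator R_x (R_v k) = lambda *: R_v k + R_v k.+1.
Proof. by rewrite /R_v /= addrC subrK. Qed.

Lemma R_V_linear : linear R_V.
Proof.
move=> k u w; rewrite /R_V scaler_sumr -big_split; apply: eq_bigr => i _ /=.
by rewrite !mxE scalerDl scalerA.
Qed.
HB.instance Definition _ := GRing.isLinear.Build F _ _ _ R_V R_V_linear.

Lemma R_L2_linear : linear R_L2.
Proof. exact: ext2_lift_linear. Qed.
HB.instance Definition _ := GRing.isLinear.Build F _ _ _ R_L2 R_L2_linear.

Lemma R_fun_linear : linear R_fun.
Proof.
move=> k [s [u q]] [t [w r]]; rewrite g_linE /R_fun R_V_linear R_L2_linear.
rewrite !scalerDr scalerDl scalerA -[RHS]addrACA; congr (_ + _).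
by rewrite addrACA.
Qed.
HB.instance Definition _ := GRing.isLinear.Build F (gLie n lambda) _ _ R_fun R_fun_linear.

Lemma R_V_bvec i : R_V (bvec F i) = R_v i.
Proof.
rewrite /R_V (bigD1 i) //= big1 => [|j ne]; last by rewrite mxE eqxx (negPf ne) scale0r.
by rewrite mxE !eqxx scale1r addr0.
Qed.

Lemma R_V_upper u : exists M N, R_V u = upper_blocks M N.
Proof.
rewrite /R_V; elim/big_rec: _ => [|i X _ [M [N ->]]]; first by exists 0, 0; rewrite upper0.
by rewrite R_vE -upper_lin; do 2!eexists.
Qed.

Lemma R_L2_wedge u w : R_L2 (wedge u w) = commutator (R_V u) (R_V w).
Proof.
pose f u w := commutator (R_V u) (R_V w).
transitivity (ext2_lift (fun i j => f (bvec F i) (bvec F j)) (wedge u w)).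
  by apply: eq_bigr => p _; rewrite /f !R_V_bvec.
apply: (lift_bilin (f := f)) => [k u1 u2 w1|k u1 w1 w2|u1]; rewrite /f.
- by rewrite R_V_linear commutatorPl.
- by rewrite R_V_linear commutatorPr.
by rewrite commutator_alt.
Qed.

Lemma R_L2_corner q : exists Y, R_L2 q = corner_block _ Y.
Proof.
rewrite /R_L2 /ext2_lift; elim/big_rec: _ => [|p X _ [Y ->]].
  by exists 0; rewrite corner0.
rewrite !R_vE /commutator !upper_upper -[_ - _]addrC -scaleN1r -corner_lin -corner_lin.
by eexists.
Qed.

Lemma R_x_V u : commutator R_x (R_V u) = R_V (adxV lambda u).
Proof.
have -> : adxV lambda u = \sum_i u 0 i *: adxV lambda (bvec F i).
  by rewrite {1}(row_sum_delta u) linear_sum; apply: eq_bigr => i _; rewrite linearZ.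
rewrite [RHS]linear_sum [in LHS]/R_V linear_sum; apply: eq_bigr => i _.
rewrite !linearZ /=; congr (_ *: _); rewrite R_v_step adxVE; set Z := R_v i.+1.
rewrite linearD linearZ /= R_V_bvec; congr (_ + _).
case: insubP => [j _ jE|]; first by rewrite R_V_bvec jE.
rewrite -leqNgt => le_n; have iE : i.+1 = n by apply/eqP; rewrite eqn_leq le_n andbT.
by rewrite /Z iE R_v_nil linear0.
Qed.

Lemma R_x_L2 q : commutator R_x (R_L2 q) = R_L2 (adxL2 lambda q).
Proof.
have -> : q = \sum_p (q p : F) *: wedge (bvec F (val p).1) (bvec F (val p).2).
  exact: ext2_span.
move: (fun p => q p : F) => k.
elim/big_rec: _ => [|p r _ IHr]; first by rewrite !linear0.
rewrite [R_L2 (_ + _)]linearD [adxL2 _ (_ + _)]linearD !linearD /= IHr.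
congr (_ + _); rewrite [R_L2 (_ *: _)]linearZ [adxL2 _ (_ *: _)]linearZ.
rewrite [LHS]linearZ [RHS]linearZ /=; congr (_ *: _).
by rewrite R_L2_wedge commutator_der !R_x_V adxL2_wedge linearD /= !R_L2_wedge.
Qed.

Lemma R_bracket (y z : gLie n lambda) :
  R_fun (lie_bracket y z) = commutator (R_fun y) (R_fun z).
Proof.
case: y z => s [u q] [t [w r]].
have VL u1 q1 : commutator (R_V u1) (R_L2 q1) = 0.
  have [M [N ->]] := R_V_upper u1; have [Y ->] := R_L2_corner q1.
  by rewrite /commutator upper_corner corner_upper subr0.
have LL q1 q2 : commutator (R_L2 q1) (R_L2 q2) = 0.
  have [Y ->] := R_L2_corner q1; have [Y' ->] := R_L2_corner q2.
  by rewrite /commutator !corner_corner subr0.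
have cD X Y Z : commutator (X + Y) Z = commutator X Z + commutator Y Z.
  by rewrite -[X]scale1r commutatorPl !scale1r.
have cZ k X Z : commutator (k *: X) Z = k *: commutator X Z.
  by rewrite -[k *: X]addr0 commutatorPl [commutator 0 _]commutatorC linear0 oppr0 addr0.
rewrite /lie_bracket /= /R_fun /= scale0r add0r !cD !linearD /= !cZ !linearZ /=.
rewrite commutator_alt VL LL [commutator (R_L2 q) (R_V w)]commutatorC VL.
rewrite [commutator (R_V u) R_x]commutatorC [commutator (R_L2 q) R_x]commutatorC.
rewrite !R_x_V !R_x_L2 !scaler0 oppr0 !addr0 add0r.
rewrite [R_V (- _)]linearN [R_L2 (- _)]linearN /= R_L2_wedge.
move: (commutator _ _) => C; rewrite -!addrA; congr (_ + _).
by rewrite [RHS]addrCA; congr (_ + _); rewrite addrCA.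
Qed.

Definition R_rep : lieRep (gLie n lambda) rep_dim := LieRep R_bracket.

Lemma R_rep_x : R_rep (g_x n lambda) = R_x.
Proof. by rewrite /= /R_fun linear0 [R_L2 0]linear0 !addr0 scale1r. Qed.

Lemma R_rep_v (k : 'I_n) : R_rep (g_V lambda (bvec F k)) = R_v k.
Proof. by rewrite /= /R_fun R_V_bvec [R_L2 0]linear0 scale0r add0r addr0. Qed.

Lemma R_rep_wedge (u w : 'rV[F]_n) :
  R_rep (g_L2 lambda (wedge u w)) =
  commutator (R_rep (g_V lambda u)) (R_rep (g_V lambda w)).
Proof.
by rewrite /= /R_fun !linear0 scale0r !add0r !addr0 R_L2_wedge.
Qed.

End TheRepresentation.

(* "Relatively faithful" is only defined for uniserial representations. *)
Definition relatively_faithful (F : fieldType) (n : nat) (lambda : F) (d : nat)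
    (rho : lieRep (gLie n lambda) d) : Prop :=
  [/\ uniserial rho,
      proper_vs (rep_ker rho :&: subL2 n lambda)%VS (subL2 n lambda) &
      (rep_ker rho :&: subV n lambda)%VS = 0%VS].

Section Normalized.
Variables (F : fieldType) (n : nat) (D : rep_data F n).

Definition normalized : Prop :=
  [/\ row (ord_last (dim_a_gt0 D)) (mx_M D) = delta_mx 0 (ord_first (dim_b_gt0 D)),
      row (ord_last (dim_b_gt0 D)) (mx_N D) = delta_mx 0 (ord_first (dim_c_gt0 D)) &
      col (ord_first (dim_b_gt0 D)) (mx_M D) = delta_mx (ord_last (dim_a_gt0 D)) 0].

(* Rows are numbered from 0 here: N_{i,1} with i even is an odd row index. *)
Definition extreme_type : Prop :=
  [/\ odd n, dim_a D = 1%N, dim_c D = 1%N &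
      forall i : 'I_(dim_b D), odd i -> mx_N D i (ord_first (dim_c_gt0 D)) = 0].

End Normalized.

(* Main.v *)
(**
Write S X = J X - X J for the nilpotent Jordan blocks J, so that R(v_k) has blocks S^k M and S^k N.

Every R(y) is upper triangular, and each superdiagonal position (i, i+1) is nonzero in R(x) (inside a block) or in R(v_0) (between two blocks), with equal diagonal entries at i and i+1. Hence the submodules are exactly the terms of the standard flag, and R is uniserial.

The lowest nonzero diagonal of S^k X is governed by binomial coefficients times the bottom left entry of X. In characteristic 0 this gives S^(n-1) M <> 0 or S^(n-1) N <> 0, whereas S^n kills both, so R is injective on V. It also gives [R(v_0), R(v_b)] <> 0 unless a = c = 1. If a = c = 1, then S^i M S^j N = (-1)^i M S^(i+j) N, whose only entry is, up to sign, the entry of N of index i+j, counted from 0; all brackets vanish exactly when these entries vanish for i+j odd.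

An isomorphism intertwines the matrices R(x), whose blocks have the distinct eigenvalues alpha, alpha - lambda, alpha - 2 lambda. So alpha and the block sizes agree, and the isomorphism is block diagonal with blocks commuting with J. The normalization forces the blocks to be one common scalar, whence M = M' and N = N'.
*)
From HB Require Import structures.
Require Import Defs.
From mathcomp Require Import all_boot all_order all_algebra ring zify.
Import GRing.Theory.
Local Open Scope ring_scope.
Set Implicit Arguments.
Unset Strict Implicit.
Unset Printing Implicit Defensive.

(** * The shift operator on matrix entries *)

Lemma sum_delta (F : fieldType) (p : nat) (f : 'I_p -> F) k :
  \sum_(l < p) (k == l :> nat)%:R * f l = oapp f 0 (insub k).
Proof.
case: insubP => [l0 _ <-|/negPf lt_k] /=.
  rewrite (bigD1 l0) //= eqxx mul1r big1 ?addr0 // => l ne.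
  by rewrite [_ == _]eq_sym val_eqE (negPf ne) mul0r.
by rewrite big1 // => l _; case: eqP => [kE|]; [rewrite kE ltn_ord in lt_k | rewrite mul0r].
Qed.

Section Shift.
Variables (F : fieldType) (p q : nat).
Implicit Types X : 'M[F]_(p, q).

(* Entries indexed by natural numbers, read as 0 out of range. *)
Definition entry X (i j : nat) : F :=
  oapp (fun i' => oapp (X i') 0 (insub j)) 0 (insub i).

Lemma entryE X (i : 'I_p) (j : 'I_q) : entry X i j = X i j.
Proof. by rewrite /entry !valK. Qed.

Lemma entry_rowE X (i : 'I_p) j : entry X i j = oapp (X i) 0 (insub j).
Proof. by rewrite /entry valK. Qed.

Lemma entry_colE X i (j : 'I_q) : entry X i j = oapp (X^~ j) 0 (insub i).
Proof. by rewrite /entry valK. Qed.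

Lemma entry0 i j : entry 0 i j = 0.
Proof. by rewrite /entry; case: (insub i) => //= ?; case: (insub j) => //= ?; rewrite mxE. Qed.

Lemma entry_row_out X i j : (p <= i)%N -> entry X i j = 0.
Proof. by move=> le_pi; rewrite /entry [insub i]insubN // -leqNgt. Qed.

(** Left multiplication by J moves rows up by one, right multiplication moves columns to the right.
    The bound on [j] matters: at [j = q] the left side reads as 0, while the right side may contain
    an entry of the last column. *)
Lemma entry_shift X i j : (j < q)%N ->
  entry (shift_mx X) i j = entry X i.+1 j - (if j is j'.+1 then entry X i j' else 0).
Proof.
move=> lt_j; case: (ltnP i p) => [lt_i|le_i]; last first.
  by rewrite !entry_row_out ?leqW //; case: j {lt_j} => [|j]; rewrite ?entry_row_out ?subr0.
rewrite (entryE _ (Ordinal lt_i) (Ordinal lt_j)) /shift_mx !mxE; congr (_ - _).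
  rewrite (entry_colE _ _ (Ordinal lt_j)) -sum_delta; apply: eq_bigr => l _.
  by rewrite !mxE mul0rn add0r.
under eq_bigr => l _ do rewrite !mxE mul0rn add0r mulrC.
case: j lt_j => [|j] lt_j; first by rewrite big1 // => l _; rewrite mul0r.
rewrite (entry_rowE _ (Ordinal lt_i)) -sum_delta.
by apply: eq_bigr => l _; rewrite eqSS eq_sym.
Qed.

(** The equation between [k], [i] and [j] describes the lowest diagonal that S^k X can occupy;
    Pascal's rule drives the induction along it. *)
Lemma entry_shift_iter_corner X k i j :
    (i < p)%N -> (j < q)%N -> (k + i.+1 = p + j)%N ->
  entry (iter k (@shift_mx F p q) X) i j = (-1) ^+ j * 'C(k, j)%:R * entry X p.-1 0.
Proof.
elim: k i j => [|k IHk] i j lt_i lt_j ijk.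
  have [-> ->] : (j = 0 /\ i = p.-1)%N by lia.
  by rewrite mul1r mul1r.
rewrite iterS entry_shift //.
have IHl : (i.+1 < p)%N ->
    entry (iter k (@shift_mx F p q) X) i.+1 j = (-1) ^+ j * 'C(k, j)%:R * entry X p.-1 0.
  by move=> lt_i1; apply: IHk => //; lia.
(* In the last row the neighbour below reads as 0, and there [j = k + 1]. *)
have [lt_i1|le_i1] := ltnP i.+1 p; last first.
  rewrite entry_row_out //; have -> : j = k.+1 by lia.
  rewrite IHk; [|lia|lia|lia].
  by rewrite !binn exprS !mulr1 mulN1r mulNr sub0r.
rewrite IHl //; case: j lt_j ijk {IHl} => [|j] lt_j ijk.
  by rewrite !bin0 subr0.
rewrite IHk; [|lia|lia|lia].
by rewrite binS natrD exprS; ring.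
Qed.

Lemma entry_shift_iter0 X k i : (0 < q)%N ->
  entry (iter k (@shift_mx F p q) X) i 0 = entry X (i + k) 0.
Proof.
move=> q_gt0; elim: k i => [|k IHk] i; first by rewrite addn0.
by rewrite iterS entry_shift // subr0 IHk addSnnS.
Qed.

Lemma shift_mx_linear : linear (@shift_mx F p q).
Proof.
move=> k X Y; rewrite /shift_mx mulmxDr mulmxDl -scalemxAr -scalemxAl.
by rewrite scalerBr opprD addrACA.
Qed.
HB.instance Definition _ := GRing.isLinear.Build F _ _ _ (@shift_mx F p q) shift_mx_linear.

Lemma jordan_intertwinerE (beta gamma : F) X :
    jordan p beta *m X = X *m jordan q gamma ->
  shift_mx X = (gamma - beta) *: X.
Proof.
rewrite (jordanE p) (jordanE q) mulmxDl mulmxDr mul_scalar_mx mul_mx_scalar => e.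
rewrite /shift_mx scalerBl; apply/eqP; rewrite subr_eq addrAC eq_sym subr_eq.
by rewrite eq_sym [X in X == _]addrC e.
Qed.

(** The relation says S X = (gamma - beta) X with a nonzero scalar, and S is nilpotent. *)
Lemma jordan_intertwiner_neq (beta gamma : F) X :
  jordan p beta *m X = X *m jordan q gamma -> beta != gamma -> X = 0.
Proof.
move=> /jordan_intertwinerE SX neq.
have SkX k : iter k (@shift_mx F p q) X = (gamma - beta) ^+ k *: X.
  elim: k => [|k IHk]; first by rewrite scale1r.
  by rewrite iterS IHk linearZ /= SX scalerA exprSr.
have /eqP := SkX (p + q)%N; rewrite shift_nil // eq_sym scaler_eq0.
by rewrite expf_eq0 subr_eq0 [gamma == _]eq_sym (negPf neq) andbF => /eqP.
Qed.

End Shift.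

(** The two terms X J Y cancel, so S is a derivation. *)
Lemma shift_mxM (F : fieldType) p q r (X : 'M[F]_(p, q)) (Y : 'M[F]_(q, r)) :
  shift_mx (X *m Y) = shift_mx X *m Y + X *m shift_mx Y.
Proof. by rewrite /shift_mx mulmxBl mulmxBr !mulmxA addrA subrK. Qed.

(** * Matrices commuting with a nilpotent Jordan block *)

Section Toeplitz.
Variables (F : fieldType) (p : nat) (X : 'M[F]_p).
Hypothesis SX : shift_mx X = 0.

Lemma toeplitz_step i j : (j.+1 < p)%N -> entry X i.+1 j.+1 = entry X i j.
Proof.
move=> lt_j; have := entry_shift X i lt_j; rewrite SX entry0.
by move/esym/eqP; rewrite subr_eq0 => /eqP.
Qed.

Lemma toeplitz_first_col i : (0 < p)%N -> entry X i.+1 0 = 0.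
Proof.
by move=> p_gt0; have := entry_shift X i p_gt0; rewrite SX subr0 entry0 => <-.
Qed.

(** A matrix killed by S is constant along diagonals and zero below the main one, so its first row
    determines it. *)
Lemma toeplitz_first_row x :
  (forall j, (j < p)%N -> entry X 0 j = x *+ (0 == j)%N) -> X = x%:M.
Proof.
move=> row0; apply/matrixP=> i j; rewrite !mxE -entryE.
case: i j => [i lt_i] [j lt_j]; rewrite -val_eqE /=.
elim: i j lt_i lt_j => [|i IHi] [|j] lt_i lt_j; rewrite ?row0 //.
  by rewrite toeplitz_first_col.
by rewrite toeplitz_step // IHi // ltnW.
Qed.

Lemma toeplitz_last_col x :
  (forall i, (i < p)%N -> entry X i p.-1 = x *+ (i == p.-1)%N) -> X = x%:M.
Proof.
(* Here [m] is the distance from column [j] to the last column. *)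
move=> coln; suff eX m : forall i j, (j + m = p.-1)%N -> (j < p)%N -> entry X i j = x *+ (i == j).
  apply/matrixP=> i j; rewrite !mxE -entryE (eX (p.-1 - j)%N) //.
  by have := ltn_ord j; lia.
elim: m => [|m IHm] i j ej lt_j.
  have -> : j = p.-1 by lia.
  have [lt_i|le_i] := ltnP i p; first exact: coln.
  rewrite entry_row_out //; have /negPf-> // : i != p.-1 by lia.
by rewrite -toeplitz_step ?IHm ?eqSS //; lia.
Qed.

End Toeplitz.

(** * Uniserial representations by triangular matrices *)

Section Flag.
Variables (F : fieldType) (d : nat).

(** The standard flag is obtained as the kernels of these projections. *)
Definition tail_part (k : nat) (u : 'cV[F]_d) : 'cV[F]_d :=
  \col_i (if (i < k)%N then 0 else u i 0).

Lemma tail_part_linear k : linear (tail_part k).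
Proof. by move=> x u v; apply/colP=> i; rewrite !mxE; case: ifP; rewrite ?mulr0 ?addr0. Qed.
HB.instance Definition _ k :=
  GRing.isLinear.Build F _ _ _ (tail_part k) (tail_part_linear k).

Definition flag k : {vspace 'cV[F]_d} := lker (linfun (tail_part k)).

Lemma flagP k (u : 'cV[F]_d) : reflect (forall i : 'I_d, (k <= i)%N -> u i 0 = 0) (u \in flag k).
Proof.
rewrite memv_ker lfunE /=; apply: (iffP eqP) => [/colP u0 i|u0].
  by move=> le_ki; have := u0 i; rewrite !mxE ltnNge le_ki.
by apply/colP=> i; rewrite !mxE; case: ltnP => // /u0.
Qed.

Lemma flag0 : flag 0 = 0%VS.
Proof.
apply/vspaceP=> u; rewrite memv0; apply/flagP/eqP => [u0|-> i _]; last by rewrite mxE.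
by apply/colP=> i; rewrite u0 ?mxE.
Qed.

Lemma flag_full : flag d = fullv.
Proof.
apply/vspaceP=> u; rewrite memvf; apply/flagP => i; have := ltn_ord i; lia.
Qed.

Lemma flag_leq k l : (k <= d)%N -> (flag k <= flag l)%VS = (k <= l)%N.
Proof.
move=> le_kd; apply/idP/idP => [/subvP le_fl|le_kl]; last first.
  by apply/subvP=> u /flagP u0; apply/flagP=> i le_li; apply: u0; apply: leq_trans le_li.
case: (leqP k l) => // lt_lk; have lt_ld := leq_trans lt_lk le_kd.
have /flagP/(_ (Ordinal lt_ld) (leqnn l))/eqP : delta_mx (Ordinal lt_ld) 0 \in flag l.
  apply: le_fl; apply/flagP=> i le_ki; rewrite mxE andbT -val_eqE /=.
  by case: eqP => // iE; move: le_ki; rewrite iE leqNgt lt_lk.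
by rewrite mxE !eqxx oner_eq0.
Qed.

Lemma flag_inj k l : (k <= d)%N -> (l <= d)%N -> flag k = flag l -> k = l.
Proof.
move=> le_kd le_ld e; apply/eqP; rewrite eqn_leq.
by rewrite -(flag_leq l le_kd) -(flag_leq k le_ld) e subvv.
Qed.

End Flag.

Section UpperTriangular.
Variables (F : fieldType) (L : lieAlgType F) (d : nat) (rho : lieRep L d).

Hypothesis triangular : forall y (i j : 'I_d), (j < i)%N -> rho y i j = 0.
(* For such a [y], [rho y - rho y i i] maps a vector of [flag j.+1] outside
   [flag j] to a vector of [flag i.+1] outside [flag i]. *)
Hypothesis superdiagonal : forall i j : 'I_d, j = i.+1 :> nat ->
  exists2 y, rho y i i = rho y j j & rho y i j != 0.

Lemma submodule_flag k : submodule rho (flag F d k).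
Proof.
move=> y u /flagP u0; apply/flagP=> i le_ki; rewrite mxE big1 // => j _.
by case: (ltnP j i) => [/triangular->|le_ij]; rewrite ?mul0r // u0 ?mulr0 // (leq_trans le_ki).
Qed.

Lemma submodule_lower U (i j : 'I_d) u : submodule rho U -> j = i.+1 :> nat ->
  u \in U -> u \in flag F d j.+1 -> u j 0 != 0 ->
  exists2 w, w \in U & w \in flag F d i.+1 /\ w i 0 != 0.
Proof.
move=> subU ji Uu /flagP u0 uj.
have [y yij nz_y] := superdiagonal ji; exists (rho y *m u - rho y j j *: u).
  by rewrite rpredB ?rpredZ // subU.
have tail (k : 'I_d) : (i <= k)%N -> (rho y *m u) k 0 = rho y k i * u i 0 + rho y k j * u j 0.
  move=> le_ik; have nij : j != i by rewrite -val_eqE /= ji; lia.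
  rewrite mxE (bigD1 i) //= (bigD1 j) //= big1 ?addr0 // => l /andP[nli nlj].
  case: (ltnP l k) => [/triangular->|le_kl]; rewrite ?mul0r // u0 ?mulr0 //.
  by move: nli nlj; rewrite -!val_eqE /=; lia.
move: (rho y *m u) tail => z tail; split.
  apply/flagP=> k lt_ik; rewrite !mxE tail 1?ltnW // [rho y k i]triangular // mul0r add0r.
  have [lt_jk|le_kj] := ltnP j k.
    by rewrite triangular // mul0r u0 // mulr0 subr0.
  have -> : k = j by apply: val_inj => /=; lia.
  exact: subrr.
by rewrite !mxE tail // yij [X in X - _]addrC addrK mulf_neq0.
Qed.

(** Let [k] be least with [U] inside [flag k]. If [k > 0], minimality gives a vector of [U] with
    nonzero coordinate of index [k - 1]; lowering it step by step yields pivots at all smaller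
    indices, and elimination puts [flag k] inside [U]. *)
Lemma submodule_eq_flag U : submodule rho U -> exists2 k, (k <= d)%N & U = flag F d k.
Proof.
move=> subU; have [k /andP[le_kd leUk] min_k] : {k | (k <= d)%N && (U <= flag F d k)%VS
    & forall m, (m <= d)%N && (U <= flag F d m)%VS -> (k <= m)%N}.
  by apply: find_ex_minn; exists d; rewrite leqnn flag_full subvf.
exists k => //; apply: subv_anti; rewrite leUk /=.
have pivot m : (m <= k)%N -> forall j : 'I_d, (j.+1 + m = k)%N ->
    exists2 w, w \in U & w \in flag F d j.+1 /\ w j 0 != 0.
  elim: m => [|m IHm] le_mk j jm.
    rewrite addn0 in jm; have [/hasP[u Uu uj]|/hasPn all0] := boolP (has (fun u : 'cV_d => u j 0 != 0) (vbasis U)).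
      exists u; first exact: vbasis_mem.
      by rewrite jm; split=> //; apply: (subvP leUk); apply: vbasis_mem.
    suff /min_k : (j <= d)%N && (U <= flag F d j)%VS by rewrite -jm ltnn.
    rewrite ltnW //=.
    rewrite -(span_basis (vbasisP U)); apply/span_subvP => u Uu; apply/flagP=> i.
    rewrite leq_eqVlt => /orP[/eqP/val_inj <-|lt_ji]; first by have := all0 _ Uu; rewrite negbK => /eqP.
    by move/subvP: leUk => /(_ u (vbasis_mem Uu))/flagP->; rewrite // -jm.
  have lt_j1 : (j.+1 < d)%N by lia.
  have [|u Uu [fu uj]] := IHm (ltnW le_mk) (Ordinal lt_j1) => /=; first by lia.
  exact: (submodule_lower subU _ Uu fu uj).
suff all_m m : (m <= k)%N -> (flag F d m <= U)%VS by exact: all_m.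
elim: m => [|m IHm] lt_mk; first by rewrite flag0 sub0v.
have lt_md := leq_trans lt_mk le_kd.
have [||w Uw [fw wm]] := pivot (k - m.+1)%N _ (Ordinal lt_md) => /=; [lia|lia|].
(* Clearing coordinate [m] of [u] with the pivot vector [w] leaves a vector of [flag m]. *)
apply/subvP=> u fu; rewrite -[u](subrK (u (Ordinal lt_md) 0 / w (Ordinal lt_md) 0 *: w)).
apply: rpredD; last by rewrite rpredZ.
apply: (subvP (IHm (ltnW lt_mk))); apply/flagP=> i.
rewrite leq_eqVlt => /orP[/eqP e|lt_mi]; rewrite !mxE.
  have -> : i = Ordinal lt_md by apply: val_inj.
  by rewrite divfK ?subrr.
by rewrite (flagP _ _ fu i) // (flagP _ _ fw i) // mulr0 subr0.
Qed.

(** By the classification of submodules, each step of a composition series goes from [flag i] to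
    some [flag k] with [k > i]; simplicity tested on [flag i.+1] forces [k = i + 1]. *)
Lemma uniserial_of_superdiagonal : uniserial rho.
Proof.
have nthE i : (i <= d)%N -> nth 0%VS (0%VS :: [seq flag F d k | k <- iota 1 d]) i = flag F d i.
  move=> le_id; rewrite -(flag0 F d).
  have -> : flag F d 0 :: [seq flag F d k | k <- iota 1 d] = [seq flag F d k | k <- iota 0 d.+1] by [].
  by rewrite (nth_map 0%N) ?size_iota ?ltnS // nth_iota.
exists [seq flag F d k | k <- iota 1 d]; split.
  split=> [|i].
    by rewrite -(flag0 F d) last_map -flag_full -nth_last size_iota; case: (d) => // m; rewrite nth_iota.
  rewrite size_map size_iota => lt_id; rewrite nthE 1?ltnW //.
  rewrite (nth_map 0%N) ?size_iota // nth_iota // add1n.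
  split; try exact: submodule_flag.
    rewrite /proper_vs (flag_leq F _ (ltnW lt_id)) leqnSn /=.
    by apply/eqP=> /flag_inj; rewrite (ltnW lt_id) lt_id => /(_ isT isT) /eqP; rewrite ltn_eqF.
  move=> X /submodule_eq_flag[k le_kd ->]; rewrite (flag_leq F _ (ltnW lt_id)) (flag_leq F _ le_kd) => le_ik le_ki.
  by have [->|lt_ik] := eqVneq i k; [left|right; congr flag; lia].
move=> s [last_s comp_s].
have s_flag i : (i <= size s)%N -> (i <= d)%N /\ nth 0%VS (0%VS :: s) i = flag F d i.
  elim: i => [|i IHi] le_is; first by rewrite flag0.
  rewrite -[nth _ _ i.+1]/(nth 0%VS s i).
  have [le_id sE] := IHi (ltnW le_is); have [_ + + +] := comp_s _ le_is.
  rewrite sE => /submodule_eq_flag[k le_kd ->] /andP[]; rewrite flag_leq // => le_ik ne min_ik.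
  have lt_ik : (i < k)%N by rewrite ltn_neqAle le_ik andbT; apply: contra ne => /eqP->.
  have lt_id := leq_trans lt_ik le_kd; split=> //.
  have [|||e|->] // := min_ik (flag F d i.+1); rewrite ?flag_leq //.
    exact: submodule_flag.
  by have /eqP := flag_inj lt_id le_id e; rewrite gtn_eqF.
have [le_sd lastE] := s_flag _ (leqnn _).
have size_s : size s = d.
  by apply: (@flag_inj F d) => //; rewrite -lastE nth_last /= last_s flag_full.
apply: (@eq_from_nth _ 0%VS); rewrite size_map size_iota // => i lt_id.
have := nthE i.+1 lt_id; rewrite /= => ->.
by have [|_ /= ->] := s_flag i.+1; rewrite // size_s.
Qed.

End UpperTriangular.

(** * The representations R are uniserial *)

Definition triangular_mx (F : fieldType) d (X : 'M[F]_d) :=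
  forall i j : 'I_d, (j < i)%N -> X i j = 0.

Lemma triangular_jordan (F : fieldType) p (beta : F) : triangular_mx (jordan p beta).
Proof. by move=> i j lt_ji; rewrite !mxE -val_eqE /= !gtn_eqF ?addr0 // ltnW. Qed.

Lemma triangular_block (F : fieldType) p q (X : 'M[F]_p) Y (Z : 'M[F]_q) :
  triangular_mx X -> triangular_mx Z -> triangular_mx (block_mx X Y 0 Z).
Proof.
move=> trX trZ i j; case: (split_ordP i) => i' ->; case: (split_ordP j) => j' -> /= lt_ji.
- by rewrite block_mxEul trX.
- by have := ltn_ord i'; lia.
- by rewrite block_mxEdl mxE.
- by rewrite block_mxEdr trZ // -(ltn_add2l p).
Qed.

Lemma triangular0 (F : fieldType) p : triangular_mx (0 : 'M[F]_p).
Proof. by move=> i j _; rewrite mxE. Qed.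

Lemma triangularD (F : fieldType) p (X Y : 'M[F]_p) :
  triangular_mx X -> triangular_mx Y -> triangular_mx (X + Y).
Proof. by move=> trX trY i j lt_ji; rewrite mxE trX ?trY ?addr0. Qed.

Lemma triangularZ (F : fieldType) p k (X : 'M[F]_p) :
  triangular_mx X -> triangular_mx (k *: X).
Proof. by move=> trX i j lt_ji; rewrite mxE trX ?mulr0. Qed.

Lemma R_rep_triangular (F : fieldType) (n : nat) (lambda : F) (D : rep_data F n)
    (y : gLie n lambda) : triangular_mx (R_rep lambda D y).
Proof.
case: y => s [u q] i j lt_ji; have [M [N VE]] := R_V_upper lambda D u.
have [Y LE] := R_L2_corner lambda D q.
rewrite -[R_rep lambda D _]/((s : F) *: R_x lambda D + R_V lambda D u + R_L2 lambda D q) VE LE.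
apply: triangularD lt_ji; last by apply: triangular_block; try apply: triangular0.
apply: triangularD; last by apply: triangular_block; try apply: triangular_block; apply: triangular0.
apply: triangularZ; apply: triangular_block; try apply: triangular_block; exact: triangular_jordan.
Qed.

(** Inside a diagonal block x serves. At the two junctions v_0 serves: its diagonal is zero and its
    entry there is the bottom left entry of M or N. *)
Lemma R_rep_superdiagonal (F : fieldType) (n : nat) (n_gt0 : (0 < n)%N) (lambda : F)
    (D : rep_data F n) (i j : 'I_(rep_dim D)) : j = i.+1 :> nat ->
  exists2 y : gLie n lambda, R_rep lambda D y i i = R_rep lambda D y j j &
                             R_rep lambda D y i j != 0.
Proof.
have jordan_sup p (beta : F) (k l : 'I_p) : l = k.+1 :> nat ->
    jordan p beta k k = jordan p beta l l /\ jordan p beta k l != 0.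
  move=> lk; rewrite !mxE lk !eqxx !gtn_eqF // !addr0; split=> //.
  by rewrite -val_eqE /= lk ltn_eqF // add0r oner_neq0.
move: i j; rewrite /rep_dim => i j ji.
have Rv : R_rep lambda D (g_V lambda (bvec F (Ordinal n_gt0))) = upper_blocks (mx_M D) (mx_N D).
  by rewrite R_rep_v.
have last_first p q (p_gt0 : (0 < p)%N) (q_gt0 : (0 < q)%N) (k : 'I_p) (l : 'I_q) :
    (p + l = k.+1)%N -> k = ord_last p_gt0 /\ l = ord_first q_gt0.
  by have := ltn_ord k; split; apply: val_inj => /=; lia.
have xE : R_rep lambda D (g_x n lambda) = diag_blocks _ _ _ := R_rep_x lambda D.
case: (split_ordP i) ji => i' -> {i}; case: (split_ordP j) => j' -> {j} /=; last first.
- move=> /eqP; rewrite -addnS eqn_add2l => /eqP ji.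
  have [e nz] := jordan_sup _ (eig D - lambda *+ 2) _ _ ji.
  by exists (g_x n lambda); rewrite xE /diag_blocks !block_mxEdr.
- by have := ltn_ord j'; lia.
- move=> ji; exists (g_V lambda (bvec F (Ordinal n_gt0))); rewrite Rv /upper_blocks.
    rewrite block_mxEul block_mxEdr [RHS]mxE.
    by case: (split_ordP i') => k ->; rewrite ?block_mxEul ?block_mxEdr [LHS]mxE.
  rewrite block_mxEur; case: (split_ordP i') ji => k -> /= ji; first by have := ltn_ord k; have := dim_b_gt0 D; lia.
  have [-> ->] : k = ord_last (dim_b_gt0 D) /\ j' = ord_first (dim_c_gt0 D).
    by apply: last_first; lia.
  by rewrite col_mxEd mx_N_neq0.
case: (split_ordP i') => k -> {i'}; case: (split_ordP j') => l -> {j'} /=; last first.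
- move=> /eqP; rewrite -addnS eqn_add2l => /eqP ji.
  have [e nz] := jordan_sup _ (eig D - lambda) _ _ ji.
  by exists (g_x n lambda); rewrite xE /diag_blocks !block_mxEul !block_mxEdr.
- by have := ltn_ord l; lia.
- move=> ji; exists (g_V lambda (bvec F (Ordinal n_gt0))); rewrite Rv /upper_blocks.
    by rewrite !block_mxEul block_mxEdr [LHS]mxE [RHS]mxE.
  rewrite block_mxEul block_mxEur.
  have [-> ->] : k = ord_last (dim_a_gt0 D) /\ l = ord_first (dim_b_gt0 D).
    by apply: last_first; lia.
  by rewrite mx_M_neq0.
move=> ji; have [e nz] := jordan_sup _ (eig D) _ _ ji.
by exists (g_x n lambda); rewrite xE /diag_blocks !block_mxEul.
Qed.

Lemma R_rep_uniserial (F : fieldType) (n : nat) (n_gt0 : (0 < n)%N) (lambda : F)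
  (D : rep_data F n) : uniserial (R_rep lambda D).
Proof.
apply: uniserial_of_superdiagonal => [y i j|i j]; first exact: R_rep_triangular.
exact: R_rep_superdiagonal.
Qed.

(** * Nilpotency and commutation of shifts *)

(** Once the coefficients below [k] vanish, applying f^(n-1-k) to the relation leaves only the
    coefficient of index [k] times f^(n-1) x. *)
Lemma nilpotent_orbit_free (F : fieldType) (V : lmodType F) (f : {linear V -> V}) n (x : V)
    (u : 'rV[F]_n) :
  iter n f x = 0 -> iter n.-1 f x != 0 -> \sum_k u 0 k *: iter k f x = 0 -> u = 0.
Proof.
move=> nil nz sum0; have iter_sum m : \sum_k u 0 k *: iter (m + k) f x = 0.
  elim: m => [//|m IHm]; transitivity (f (\sum_k u 0 k *: iter (m + k) f x)).
    by rewrite linear_sum; apply: eq_bigr => k _; rewrite linearZ.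
  by rewrite IHm linear0.
have high k : (n <= k)%N -> iter k f x = 0.
  by move=> /subnK <-; rewrite iterD nil; elim: (k - n)%N => //= m ->; rewrite linear0.
suff u0 m : forall k : 'I_n, (k < m)%N -> u 0 k = 0 by apply/rowP=> k; rewrite mxE (u0 n).
elim: m => // m IHm k; rewrite ltnS leq_eqVlt => /orP[/eqP km|]; last exact: IHm.
have := iter_sum (n.-1 - k)%N; rewrite (bigD1 k) //= big1 => [|l nlk].
  rewrite subnK ?addr0; last by have := ltn_ord k; lia.
  by move/eqP; rewrite scaler_eq0 (negPf nz) orbF => /eqP.
case: (ltnP l k) => [lt_lk|le_kl]; first by rewrite IHm ?scale0r // -km.
rewrite high ?scaler0 //; move: nlk; rewrite -val_eqE /=; have := ltn_ord k; lia.
Qed.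

Section Blocks.
Variables (F : fieldType) (a b c : nat).

Lemma upper_blocks_eq0 (M : 'M[F]_(a, b)) (N : 'M[F]_(b, c)) :
  upper_blocks M N = 0 -> M = 0 /\ N = 0.
Proof.
rewrite -[RHS](upper0 F a b c) => /eq_block_mx[/eq_block_mx[_ -> _ _]].
by move/eq_col_mx=> [_ ->].
Qed.

Lemma corner_block_eq0 (Y : 'M[F]_(a, c)) : corner_block b Y = 0 -> Y = 0.
Proof.
by rewrite -[RHS](corner0 F a b c) => /eq_block_mx[_ /eq_col_mx[-> _] _ _].
Qed.

Lemma upper_blocks_sum n (u : 'I_n -> F) (M : 'I_n -> 'M[F]_(a, b)) (N : 'I_n -> 'M[F]_(b, c)) :
  \sum_k u k *: upper_blocks (M k) (N k) =
  upper_blocks (\sum_k u k *: M k) (\sum_k u k *: N k).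
Proof.
elim/big_rec3: _ => [|k X Y Z _ ->]; first by rewrite upper0.
by rewrite upper_lin.
Qed.

End Blocks.

Section CharZero.
Variables (F : fieldType).
Hypothesis charF0 : [pchar F] =i pred0.

Lemma natr_eq0_char0 k : (k%:R == 0 :> F) = (k == 0)%N.
Proof. by have /pcharf0P -> := charF0. Qed.

(** The top right entry of this power is, up to sign, the bottom left entry of [M] times the
    binomial coefficient C(a+b-2, b-1). *)
Lemma shift_iter_neq0 a b (M : 'M[F]_(a, b)) :
    (0 < a)%N -> (0 < b)%N -> entry M a.-1 0 != 0 ->
  iter (a + b).-2 (@shift_mx F a b) M != 0.
Proof.
move=> a_gt0 b_gt0 nz; apply/eqP=> S0.
have [lt_b lt_a] : (b.-1 < b)%N /\ (0 < a)%N by lia.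
have := @entry_shift_iter_corner F a b M (a + b).-2 0 b.-1 lt_a lt_b.
rewrite S0 entry0 => /(_ ltac:(lia)) /esym/eqP.
rewrite !mulf_eq0 (negPf nz) natr_eq0_char0 expf_eq0 oppr_eq0 oner_eq0 andbF /= orbF.
by rewrite eqn0Ngt bin_gt0 => /negP; apply; lia.
Qed.

Section Commutation.
Variables (a b c : nat) (M : 'M[F]_(a, b)) (N : 'M[F]_(b, c)).
Hypotheses (a_gt0 : (0 < a)%N) (b_gt0 : (0 < b)%N) (c_gt0 : (0 < c)%N).
Hypothesis rowM : row (ord_last a_gt0) M = delta_mx 0 (ord_first b_gt0).
Hypothesis rowN : row (ord_last b_gt0) N = delta_mx 0 (ord_first c_gt0).

Local Notation S := (@shift_mx F _ _).

Lemma entry_last_row p q (p_gt0 : (0 < p)%N) (q_gt0 : (0 < q)%N) (X : 'M[F]_(p, q)) :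
  row (ord_last p_gt0) X = delta_mx 0 (ord_first q_gt0) -> entry X p.-1 0 = 1.
Proof.
move/rowP/(_ (ord_first q_gt0)); rewrite !mxE !eqxx /= -entryE /= subn1.
by [].
Qed.

Lemma last_row_mul (Y : 'M[F]_(b, c)) :
  row (ord_last a_gt0) (M *m Y) = row (ord_first b_gt0) Y.
Proof. by rewrite row_mul rowM -rowE. Qed.

(** Compare the second entries of the last rows. On the left it is the entry of S^b N in row 0 and
    column 1, which is [-b]; on the right S^b M has zero last row. *)
Lemma noncommuting_wide : (1 < c)%N -> M *m iter b S N <> iter b S M *m N.
Proof.
move=> c_gt1 /(congr1 (row (ord_last a_gt0))) /rowP/(_ (Ordinal c_gt1)).
rewrite last_row_mul [LHS]mxE -entryE entry_shift_iter_corner //=.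
rewrite (entry_last_row rowN) bin1 expr1 mulr1 mulN1r !mxE big1 => [/eqP|l _].
  by rewrite oppr_eq0 natr_eq0_char0 -leqn0 leqNgt b_gt0.
by rewrite shift_iter ?mul0r //= subn1 prednK // [(b + a)%N]addnC ltn_add2l.
Qed.

(** Here S^b N = 0, as N is a column of height b. In row [a - 2] of S^b M only the last entry
    survives; it is [b] up to sign, and it meets the last entry 1 of N. *)
Lemma noncommuting_tall : (1 < a)%N -> c = 1%N -> M *m iter b S N <> iter b S M *m N.
Proof.
move=> a_gt1 c1; rewrite [iter b S N]shift_nil ?c1 ?addn1 // mulmx0.
have lt_a2 : (a.-2 < a)%N by lia.
move=> /matrixP/(_ (Ordinal lt_a2) (ord_first c_gt0))/esym/eqP.
rewrite !mxE (bigD1 (ord_last b_gt0)) //= big1 => [|l nl]; last first.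
  rewrite shift_iter ?mul0r //=; move: nl; rewrite -val_eqE /=; have := ltn_ord l; lia.
rewrite addr0 -!entryE entry_shift_iter_corner //=; [|lia|lia].
rewrite (entry_last_row rowM) [X in _ * X](_ : _ = 1); last first.
  by rewrite subn1 (entry_last_row rowN).
rewrite !mulr1 mulf_eq0 expf_eq0 oppr_eq0 oner_eq0 andbF /= natr_eq0_char0.
by rewrite eqn0Ngt bin_gt0 => /negP; apply; lia.
Qed.

Hypotheses (a1 : a = 1%N) (c1 : c = 1%N).

(* On [1 x 1] matrices [S] vanishes, so the derivation rule moves it across
   the product at the cost of a sign. *)
Lemma shift_mul_move i j : iter i S M *m iter j S N = (-1) ^+ i *: (M *m iter (i + j) S N).
Proof.
have S11 (X : 'M[F]_(a, c)) : S X = 0.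
  have nil := @shift_nil F a c X 1; apply: nil; lia.
elim: i j => [|i IHi] j; first by rewrite expr0 scale1r.
have := shift_mxM (iter i S M) (iter j S N); rewrite S11 => /esym/eqP.
rewrite addr_eq0 iterS => /eqP->; rewrite -iterS IHi exprS mulN1r scaleNr.
by rewrite addnS.
Qed.

Lemma mul_shift_entry k : entry (M *m iter k S N) 0 0 = entry N k 0.
Proof.
have -> : entry (M *m iter k S N) 0 0 = (row (ord_last a_gt0) (M *m iter k S N)) 0 (ord_first c_gt0).
  have e : (a - 1 = 0)%N by rewrite a1.
  by rewrite mxE -entryE /= e.
by rewrite last_row_mul mxE -entryE entry_shift_iter0.
Qed.

Lemma mul_shift_eq0 k : (M *m iter k S N == 0) = (entry N k 0 == 0).
Proof.
rewrite -mul_shift_entry; apply/eqP/eqP => [->|e0]; first exact: entry0.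
apply/matrixP=> i j; rewrite -entryE [RHS]mxE -e0; congr entry.
  by have := ltn_ord i; lia.
by have := ltn_ord j; lia.
Qed.

(** Both sides are M S^(i+j) N, with signs (-1)^i and (-1)^j. Equal parities give equal signs;
    otherwise [i + j] is odd and the product is zero. *)
Lemma commuting_narrow : odd b ->
  (forall i : 'I_b, odd i -> N i (ord_first c_gt0) = 0) ->
  forall i j, iter i S M *m iter j S N = iter j S M *m iter i S N.
Proof.
move=> odd_b N0 i j; rewrite !shift_mul_move [(j + i)%N]addnC.
have [e|ne] := eqVneq (odd i) (odd j); first by rewrite -signr_odd e signr_odd.
suff -> : M *m iter (i + j) S N = 0 by rewrite !scaler0.
apply/eqP; rewrite mul_shift_eq0; have [lt_ij|le_ij] := ltnP (i + j) b; last by rewrite entry_row_out.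
rewrite -[0%N]/(val (ord_first c_gt0)) (entryE _ (Ordinal lt_ij)) N0 //= oddD.
by move: ne; case: (odd i); case: (odd j).
Qed.

(** Moving S^k across changes the sign for odd [k], so equality would give 2 M S^k N = 0. *)
Lemma noncommuting_narrow k : odd k -> entry N k 0 != 0 ->
  M *m iter k S N <> iter k S M *m N.
Proof.
move=> odd_k nz /eqP; have := shift_mul_move k 0; rewrite addn0 /= => ->.
rewrite -signr_odd odd_k expr1 scaleN1r -addr_eq0 -mulr2n -scaler_nat scaler_eq0.
by rewrite natr_eq0_char0 mul_shift_eq0 (negPf nz).
Qed.

End Commutation.
End CharZero.

(** * Relative faithfulness *)

Section Faithful.
Variables (F : fieldType) (n : nat) (lambda : F) (D : rep_data F n).
Hypothesis charF0 : [pchar F] =i pred0.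

Local Notation a := (dim_a D).
Local Notation b := (dim_b D).
Local Notation c := (dim_c D).
Local Notation M := (mx_M D).
Local Notation N := (mx_N D).
Local Notation S := (@shift_mx F _ _).

Lemma mem_rep_ker y : (y \in rep_ker (R_rep lambda D)) = (R_rep lambda D y == 0).
Proof. by rewrite /rep_ker memv_ker lfunE. Qed.

(** The block among M and N whose sizes sum to n + 1 is killed by S^n but not by S^(n-1), so its
    first n shifts are independent. *)
Lemma rep_ker_subV : (0 < n)%N -> (rep_ker (R_rep lambda D) :&: subV n lambda)%VS = 0%VS.
Proof.
move=> n_gt0; apply/eqP; rewrite -subv0; apply/subvP=> y /memv_capP[+ /memv_imgP[u _ yE]].
rewrite mem_rep_ker {y}yE lfunE memv0 /= /R_fun scale0r add0r [R_L2 _ _ _]linear0 addr0.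
rewrite /R_V; under eq_bigr => k _ do rewrite R_vE.
rewrite upper_blocks_sum => /eqP/upper_blocks_eq0[sumM sumN].
have entryM : entry M a.-1 0 != 0.
  by rewrite -subn1 (entryE M (ord_last (dim_a_gt0 D)) (ord_first (dim_b_gt0 D))) mx_M_neq0.
have entryN : entry N b.-1 0 != 0.
  by rewrite -subn1 (entryE N (ord_last (dim_b_gt0 D)) (ord_first (dim_c_gt0 D))) mx_N_neq0.
suff -> : u = 0 by rewrite linear0.
case/orP: (dim_cond D) => /andP[/eqP e _].
- apply: (@nilpotent_orbit_free _ _ S _ _ _ _ _ sumM); first by rewrite shift_nil ?e.
  have -> : n.-1 = (a + b).-2 by rewrite e.
  by apply: shift_iter_neq0 => //; apply: dim_a_gt0 || apply: dim_b_gt0.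
apply: (@nilpotent_orbit_free _ _ S _ _ _ _ _ sumN); first by rewrite shift_nil // addnC e.
have -> : n.-1 = (b + c).-2 by rewrite addnC e.
by apply: shift_iter_neq0 => //; apply: dim_b_gt0 || apply: dim_c_gt0.
Qed.

Lemma commutator_R_v i j :
  commutator (R_v lambda D i) (R_v lambda D j) =
  corner_block b (iter i S M *m iter j S N - iter j S M *m iter i S N).
Proof.
rewrite !R_vE /commutator !upper_upper -[_ - _]addrC -scaleN1r -corner_lin.
by rewrite scaleN1r addrC.
Qed.

(** The wedges of basis vectors span Lambda^2(V), and the image of each is the corner block of the
    difference of two products. *)
Lemma proper_rep_ker_subL2 :
  proper_vs (rep_ker (R_rep lambda D) :&: subL2 n lambda)%VS (subL2 n lambda) <->
  exists i j : 'I_n, iter i S M *m iter j S N <> iter j S M *m iter i S N.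
Proof.
rewrite /proper_vs capvSr /=; split=> [|[i [j ne]]]; last first.
  apply/eqP=> /capv_idPr /subvP/(_ (g_L2 lambda (wedge (bvec F i) (bvec F j)))).
  rewrite mem_rep_ker R_rep_wedge !R_rep_v commutator_R_v => ker.
  apply: ne; apply/eqP; rewrite -subr_eq0; apply/eqP/corner_block_eq0/eqP; apply: ker.
  by rewrite -[g_L2 _ _](lfunE (g_L2 lambda)) memv_img ?memvf.
have [/existsP[i /existsP[j /eqP ne]] _|/existsPn all_eq] :=
  boolP [exists i : 'I_n, exists j : 'I_n, iter i S M *m iter j S N != iter j S M *m iter i S N].
  by exists i, j.
case/eqP; apply/capv_idPr/subvP=> y /memv_imgP[q _ ->].
rewrite mem_rep_ker lfunE /= /R_fun scale0r add0r linear0 add0r /R_L2 /ext2_lift.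
rewrite big1 // => p _; rewrite commutator_R_v.
have /existsPn/(_ (val p).2)/negPn/eqP-> := all_eq (val p).1.
by rewrite subrr corner0 scaler0.
Qed.

Lemma normalized_noncommuting : (1 < n)%N -> normalized D ->
  (exists i j : 'I_n, iter i S M *m iter j S N <> iter j S M *m iter i S N) <->
  ~ extreme_type D.
Proof.
move=> n_gt1 [rowM rowN _]; split=> [[i [j ne]] [odd_n a1 c1 N0]|not_ext].
  have bn : b = n by case/orP: (dim_cond D) => /andP[/eqP + _]; lia.
  by apply: ne; apply: (commuting_narrow rowM a1 c1 _ N0); rewrite bn.
have n_gt0 := ltnW n_gt1.
have a_gt0 := dim_a_gt0 D; have b_gt0 := dim_b_gt0 D; have c_gt0 := dim_c_gt0 D.
suff [k lt_kn ne] : exists2 k, (k < n)%N & M *m iter k S N <> iter k S M *m N.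
  by exists (Ordinal n_gt0), (Ordinal lt_kn).
(* The larger of [a] and [c] is n + 1 - b. *)
have lt_bn : (1 < c)%N || (1 < a)%N -> (b < n)%N.
  by move=> ac; case/orP: (dim_cond D) => /andP[/eqP + le_ac]; lia.
have [c_gt1|le_c1] := ltnP 1 c.
  by exists b; [apply: lt_bn; rewrite c_gt1 | exact: (noncommuting_wide charF0 rowM rowN c_gt1)].
have c1 : c = 1%N by lia.
have [a_gt1|le_a1] := ltnP 1 a.
  by exists b; [apply: lt_bn; rewrite a_gt1 orbT | exact: (noncommuting_tall charF0 rowM rowN a_gt1 c1)].
have a1 : a = 1%N by lia.
have bn : b = n by case/orP: (dim_cond D) => /andP[/eqP + _]; lia.
(* The bound [k < n] is automatic: entries of N from row [b = n] on read as 0. *)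
suff [k odd_k nz] : exists2 k, odd k & entry N k 0 != 0.
  exists k; last exact: (noncommuting_narrow charF0 c_gt0 rowM a1 c1 odd_k nz).
  by rewrite -bn ltnNge; apply: contra nz => /entry_row_out->.
(* For even [n] the last row index n - 1 is odd, and N has the entry 1 there. *)
have [odd_n|even_n] := boolP (odd n); last first.
  exists b.-1; first by rewrite bn; case: (n) n_gt0 even_n => //= m _; rewrite negbK.
  by rewrite (entry_last_row rowN) oner_neq0.
have [/existsP[i /andP[odd_i nz]]|/existsPn N0] :=
  boolP [exists i : 'I_b, odd i && (N i (ord_first (dim_c_gt0 D)) != 0)].
  by exists i => //; rewrite (entryE _ i (ord_first (dim_c_gt0 D))).
case: not_ext; split=> // i odd_i; have := N0 i; rewrite odd_i negbK => /eqP.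
by [].
Qed.

Lemma normalized_faithful : (1 < n)%N -> normalized D ->
  relatively_faithful (R_rep lambda D) <-> ~ extreme_type D.
Proof.
move=> n_gt1 normD; have n_gt0 := ltnW n_gt1.
rewrite -normalized_noncommuting // -proper_rep_ker_subL2; split=> [[]//|prop].
by split=> //; [exact: R_rep_uniserial | exact: rep_ker_subV].
Qed.

End Faithful.

(** * Intertwiners *)

Lemma rep_iso_matrix (F : fieldType) (L : lieAlgType F) (d d' : nat)
    (rho : lieRep L d) (rho' : lieRep L d') : rep_iso rho rho' ->
  exists (P : 'M[F]_(d', d)) (Q : 'M[F]_(d, d')),
    [/\ P *m Q = 1%:M, Q *m P = 1%:M & forall y, P *m rho y = rho' y *m P].
Proof.
move=> [f [g fK gK] f_rho]; pose P := (lin1_mx (trmx \o f \o trmx))^T.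
have PE u : P *m u = f u.
  by apply: trmx_inj; rewrite trmx_mul trmxK mul_rV_lin1 /= trmxK.
have mx_eq p q (X Y : 'M[F]_(p, q)) : (forall u : 'cV_q, X *m u = Y *m u) -> X = Y.
  by move=> XY; apply: trmx_inj; apply/row_matrixP=> i; rewrite -!tr_col !colE XY.
(* [g] is not given as linear; its values on the canonical vectors still make [Q] a right inverse of
   [P], and injectivity of [f] makes it two-sided. *)
pose Q := \matrix_(i, j) g (delta_mx j 0) i 0.
have PQ : P *m Q = 1%:M.
  apply: trmx_inj; apply/row_matrixP=> j; rewrite -!tr_col; congr (_^T).
  rewrite [RHS]colE mul1mx -[RHS]gK -PE colE -mulmxA -colE; congr (_ *m _).
  by apply/colP=> i; rewrite !mxE.
exists P, Q; split=> //.
  by apply: mx_eq => u; rewrite mul1mx; apply: (can_inj fK); rewrite -!PE !mulmxA PQ mul1mx.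
by move=> y; apply: mx_eq => u; rewrite -!mulmxA !PE f_rho.
Qed.

(** * Block matrices of size three by three *)

Definition block3_mx (F : fieldType) a b c a' b' c'
  (P11 : 'M[F]_(a', a)) (P12 : 'M[F]_(a', b)) (P13 : 'M[F]_(a', c))
  (P21 : 'M[F]_(b', a)) (P22 : 'M[F]_(b', b)) (P23 : 'M[F]_(b', c))
  (P31 : 'M[F]_(c', a)) (P32 : 'M[F]_(c', b)) (P33 : 'M[F]_(c', c)) :=
  block_mx (block_mx P11 P12 P21 P22) (col_mx P13 P23) (row_mx P31 P32) P33.

Section Block3.
Variable F : fieldType.

Lemma mul_block3 a b c a' b' c' a2 b2 c2
  (P11 : 'M[F]_(a', a)) (P12 : 'M[F]_(a', b)) (P13 : 'M[F]_(a', c))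
  (P21 : 'M[F]_(b', a)) (P22 : 'M[F]_(b', b)) (P23 : 'M[F]_(b', c))
  (P31 : 'M[F]_(c', a)) (P32 : 'M[F]_(c', b)) (P33 : 'M[F]_(c', c))
  (Q11 : 'M[F]_(a, a2)) (Q12 : 'M[F]_(a, b2)) (Q13 : 'M[F]_(a, c2))
  (Q21 : 'M[F]_(b, a2)) (Q22 : 'M[F]_(b, b2)) (Q23 : 'M[F]_(b, c2))
  (Q31 : 'M[F]_(c, a2)) (Q32 : 'M[F]_(c, b2)) (Q33 : 'M[F]_(c, c2)) :
  block3_mx P11 P12 P13 P21 P22 P23 P31 P32 P33 *m
  block3_mx Q11 Q12 Q13 Q21 Q22 Q23 Q31 Q32 Q33 =
  block3_mx
    (P11 *m Q11 + P12 *m Q21 + P13 *m Q31) (P11 *m Q12 + P12 *m Q22 + P13 *m Q32)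
    (P11 *m Q13 + P12 *m Q23 + P13 *m Q33)
    (P21 *m Q11 + P22 *m Q21 + P23 *m Q31) (P21 *m Q12 + P22 *m Q22 + P23 *m Q32)
    (P21 *m Q13 + P22 *m Q23 + P23 *m Q33)
    (P31 *m Q11 + P32 *m Q21 + P33 *m Q31) (P31 *m Q12 + P32 *m Q22 + P33 *m Q32)
    (P31 *m Q13 + P32 *m Q23 + P33 *m Q33).
Proof.
rewrite /block3_mx mulmx_block mulmx_block mul_col_row add_block_mx; congr block_mx.
- by rewrite mul_block_col mul_col_mx add_col_mx.
- by rewrite mul_row_block mul_mx_row add_row_mx.
by rewrite mul_row_col.
Qed.

Lemma block3_mxP a b c a' b' c' (P : 'M[F]_(a' + b' + c', a + b + c)) :
  exists P11 P12 P13 P21 P22 P23 P31 P32 P33,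
    P = block3_mx P11 P12 P13 P21 P22 P23 P31 P32 P33.
Proof.
exists (ulsubmx (ulsubmx P)), (ursubmx (ulsubmx P)), (usubmx (ursubmx P)).
exists (dlsubmx (ulsubmx P)), (drsubmx (ulsubmx P)), (dsubmx (ursubmx P)).
exists (lsubmx (dlsubmx P)), (rsubmx (dlsubmx P)), (drsubmx P).
by rewrite /block3_mx submxK vsubmxK hsubmxK submxK.
Qed.

Lemma eq_block3 a b c a' b' c'
  (P11 Q11 : 'M[F]_(a', a)) (P12 Q12 : 'M[F]_(a', b)) (P13 Q13 : 'M[F]_(a', c))
  (P21 Q21 : 'M[F]_(b', a)) (P22 Q22 : 'M[F]_(b', b)) (P23 Q23 : 'M[F]_(b', c))
  (P31 Q31 : 'M[F]_(c', a)) (P32 Q32 : 'M[F]_(c', b)) (P33 Q33 : 'M[F]_(c', c)) :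
  block3_mx P11 P12 P13 P21 P22 P23 P31 P32 P33 =
  block3_mx Q11 Q12 Q13 Q21 Q22 Q23 Q31 Q32 Q33 ->
  [/\ [/\ P11 = Q11, P12 = Q12 & P13 = Q13], [/\ P21 = Q21, P22 = Q22 & P23 = Q23]
    & [/\ P31 = Q31, P32 = Q32 & P33 = Q33]].
Proof. by case/eq_block_mx=> /eq_block_mx[-> -> -> ->] /eq_col_mx[-> ->] /eq_row_mx[-> ->] ->. Qed.

Lemma diag_blocks3 a b c (X : 'M[F]_a) (Y : 'M[F]_b) (Z : 'M[F]_c) :
  diag_blocks X Y Z = block3_mx X 0 0 0 Y 0 0 0 Z.
Proof. by rewrite /block3_mx col_mx0 row_mx0. Qed.

Lemma upper_blocks3 a b c (M : 'M[F]_(a, b)) (N : 'M[F]_(b, c)) :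
  upper_blocks M N = block3_mx 0 M 0 0 0 N 0 0 0.
Proof. by rewrite /block3_mx row_mx0. Qed.

Lemma scalar_block3 a b c (x : F) :
  x%:M = block3_mx x%:M 0 0 0 x%:M 0 0 0 x%:M :> 'M_(a + b + c).
Proof. by rewrite -diag_blocks3 /diag_blocks !scalar_mx_block. Qed.

End Block3.

(** * Intertwiners of the matrices of x *)

Section Intertwiner.
Variables (F : fieldType) (lambda : F).
Hypothesis charF0 : [pchar F] =i pred0.
Hypothesis lambda_neq0 : lambda != 0.

Let jord a b c (alpha : F) : 'M[F]_(a + b + c) :=
  diag_blocks (jordan a alpha) (jordan b (alpha - lambda)) (jordan c (alpha - lambda *+ 2)).

(** Otherwise the first block row of [P] intertwines Jordan blocks with distinct eigenvalues and
    vanishes, against P Q = 1. *)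
Lemma intertwiner_eig a b c a' b' c' alpha alpha'
    (P : 'M[F]_(a' + b' + c', a + b + c)) (Q : 'M[F]_(a + b + c, a' + b' + c')) :
    (0 < a')%N -> P *m Q = 1%:M -> P *m jord a b c alpha = jord a' b' c' alpha' *m P ->
  exists2 i, (i <= 2)%N & alpha' = alpha - lambda *+ i.
Proof.
move=> a_gt0 + PJ.
have [eq0|ne0] := eqVneq alpha' alpha; first by exists 0%N; rewrite // subr0.
have [eq1|ne1] := eqVneq alpha' (alpha - lambda); first by exists 1%N.
have [eq2|ne2] := eqVneq alpha' (alpha - lambda *+ 2); first by exists 2%N.
have [P11 [P12 [P13 [P21 [P22 [P23 [P31 [P32 [P33 PE]]]]]]]]] := block3_mxP P.
have [Q11 [Q12 [Q13 [Q21 [Q22 [Q23 [Q31 [Q32 [Q33 ->]]]]]]]]] := block3_mxP Q.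
move: PJ; rewrite PE /jord !diag_blocks3 !mul_block3 !mulmx0 !mul0mx !addr0 !add0r.
case/eq_block3=> -[/esym/jordan_intertwiner_neq/(_ ne0)->].
move=> /esym/jordan_intertwiner_neq/(_ ne1)-> /esym/jordan_intertwiner_neq/(_ ne2)-> _ _.
rewrite scalar_block3 => /eq_block3[[+ _ _] _ _].
rewrite !mul0mx !addr0 => /matrixP/(_ (Ordinal a_gt0) (Ordinal a_gt0))/eqP.
by rewrite !mxE eqxx eq_sym oner_eq0.
Qed.

Lemma subr_mulrn_inj (x : F) i j : x - lambda *+ i = x - lambda *+ j -> i = j.
Proof.
wlog le_ij : i j / (i <= j)%N => [IH|].
  by case: (leqP i j) => [/IH//|/ltnW/IH H /esym/H].
move=> /addrI/oppr_inj/eqP; rewrite eq_sym -subr_eq0 -mulrnBr // -mulr_natr mulf_eq0.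
by rewrite (negPf lambda_neq0) natr_eq0_char0 // subn_eq0 => le_ji; apply/eqP; rewrite eqn_leq le_ij.
Qed.

(** The six off-diagonal blocks intertwine Jordan blocks with distinct eigenvalues. The diagonal
    blocks may still be rectangular here. *)
Lemma intertwiner_diag a b c a' b' c' alpha (P : 'M[F]_(a' + b' + c', a + b + c)) :
    P *m jord a b c alpha = jord a' b' c' alpha *m P ->
  exists P11 P22 P33, P = block3_mx P11 0 0 0 P22 0 0 0 P33 /\
    [/\ shift_mx P11 = 0, shift_mx P22 = 0 & shift_mx P33 = 0].
Proof.
have [P11 [P12 [P13 [P21 [P22 [P23 [P31 [P32 [P33 ->]]]]]]]]] := block3_mxP P.
have ne i j : i != j -> alpha - lambda *+ i != alpha - lambda *+ j.
  by apply: contra => /eqP/subr_mulrn_inj->.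
have ne01 := ne 0%N 1%N isT; have ne02 := ne 0%N 2%N isT; have ne12 := ne 1%N 2%N isT.
rewrite mulr0n subr0 in ne01 ne02.
rewrite /jord !diag_blocks3 !mul_block3 !mulmx0 !mul0mx !addr0 !add0r.
have SX p q (x : F) (X : 'M[F]_(p, q)) : jordan p x *m X = X *m jordan q x -> shift_mx X = 0.
  by move/jordan_intertwinerE; rewrite subrr scale0r.
case/eq_block3=> -[e11 e12 e13] [e21 e22 e23] [e31 e32 e33].
exists P11, P22, P33; split; last by split; apply: SX; apply/esym; eassumption.
rewrite (jordan_intertwiner_neq (esym e12) ne01) (jordan_intertwiner_neq (esym e13) ne02).
rewrite (jordan_intertwiner_neq (esym e23) ne12).
rewrite (jordan_intertwiner_neq (esym e21)) 1?eq_sym //.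
rewrite (jordan_intertwiner_neq (esym e31)) 1?eq_sym //.
by rewrite (jordan_intertwiner_neq (esym e32)) 1?eq_sym.
Qed.

(** Both matrices are block diagonal, so P_ii Q_ii = 1, which bounds the number of rows of P_ii by
    its number of columns. *)
Lemma intertwiner_dim a b c a' b' c' alpha
    (P : 'M[F]_(a' + b' + c', a + b + c)) (Q : 'M[F]_(a + b + c, a' + b' + c')) :
    P *m Q = 1%:M ->
    P *m jord a b c alpha = jord a' b' c' alpha *m P ->
    Q *m jord a' b' c' alpha = jord a b c alpha *m Q ->
  [/\ (a' <= a)%N, (b' <= b)%N & (c' <= c)%N].
Proof.
move=> PQ /intertwiner_diag[P11 [P22 [P33 [PE _]]]] /intertwiner_diag[Q11 [Q22 [Q33 [QE _]]]].
move: PQ; rewrite PE QE mul_block3 scalar_block3 => /eq_block3[[e1 _ _] [_ e2 _] [_ _ e3]].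
rewrite ?(mulmx0, mul0mx, addr0, add0r) in e1 e2 e3.
by split; [exact: mulmx1_min e1 | exact: mulmx1_min e2 | exact: mulmx1_min e3].
Qed.

(** With diagonal blocks X, Y, Z the relations read X M = M' Y and Y N = N' Z. Normalization carries
    one scalar x from the last row of X to the first row of Y, on to the first row of Z, and back to
    the last column of X; each of the last three determines its Toeplitz matrix. *)
Lemma normalized_intertwiner a b c (a_gt0 : (0 < a)%N) (b_gt0 : (0 < b)%N) (c_gt0 : (0 < c)%N)
    (M M' : 'M[F]_(a, b)) (N N' : 'M[F]_(b, c)) alpha (P Q : 'M[F]_(a + b + c)) :
    row (ord_last a_gt0) M = delta_mx 0 (ord_first b_gt0) ->
    row (ord_last a_gt0) M' = delta_mx 0 (ord_first b_gt0) ->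
    row (ord_last b_gt0) N = delta_mx 0 (ord_first c_gt0) ->
    row (ord_last b_gt0) N' = delta_mx 0 (ord_first c_gt0) ->
    col (ord_first b_gt0) M = delta_mx (ord_last a_gt0) 0 ->
    col (ord_first b_gt0) M' = delta_mx (ord_last a_gt0) 0 ->
    P *m Q = 1%:M -> P *m jord a b c alpha = jord a b c alpha *m P ->
    P *m upper_blocks M N = upper_blocks M' N' *m P ->
  M = M' /\ N = N'.
Proof.
move=> rM rM' rN rN' cM cM' PQ /intertwiner_diag[X [Y [Z [PE [SX SY SZ]]]]].
rewrite PE !upper_blocks3 !mul_block3 ?(mulmx0, mul0mx, addr0, add0r).
case/eq_block3=> -[_ XM _] [_ _ YN] _.
pose x := X (ord_last a_gt0) (ord_last a_gt0).
have rowX : row (ord_last a_gt0) X = x *: delta_mx 0 (ord_last a_gt0).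
  apply/rowP=> j; rewrite !mxE /= eq_sym; case: (eqVneq (ord_last a_gt0) j) => [<-|ne]; first by rewrite mulr1.
  have lt_j : (j.+1 < a)%N by move: ne; rewrite -val_eqE /=; have := ltn_ord j; lia.
  rewrite mulr0 -entryE -(toeplitz_step SX _ lt_j) entry_row_out //=; lia.
have first_row p (p_gt0 : (0 < p)%N) (W : 'M[F]_p) :
    shift_mx W = 0 -> row (ord_first p_gt0) W = x *: delta_mx 0 (ord_first p_gt0) -> W = x%:M.
  move=> SW rW; apply: (toeplitz_first_row SW) => j lt_j.
  have /rowP/(_ (Ordinal lt_j)) := rW; rewrite !mxE -entryE /= => ->.
  by rewrite -val_eqE /= eq_sym mulr_natr.
have YE : Y = x%:M.
  apply: (first_row _ b_gt0 _ SY); have := congr1 (row (ord_last a_gt0)) XM.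
  by rewrite !row_mul rowX rM' -rowE -scalemxAl -rowE rM.
have ZE : Z = x%:M.
  apply: (first_row _ c_gt0 _ SZ); have := congr1 (row (ord_last b_gt0)) YN.
  by rewrite YE mul_scalar_mx linearZ /= row_mul rN rN' -rowE => <-.
(* Compare the first columns of X M = x M'. *)
have XE : X = x%:M.
  apply: (toeplitz_last_col SX) => i lt_i; have := congr1 (col (ord_first b_gt0)) XM.
  rewrite YE mul_mx_scalar [RHS]linearZ /= cM' colE -mulmxA -colE cM -colE => /colP/(_ (Ordinal lt_i)).
  by rewrite !mxE -entryE /= subn1 => ->; rewrite eqxx andbT mulr_natr -val_eqE /= subn1.
(* For x = 0 the matrix [P] would vanish. *)
have x_neq0 : x != 0.
  apply/eqP=> x0; move: PQ; rewrite PE XE YE ZE -scalar_block3 x0 raddf0 mul0mx.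
  move=> /matrixP/(_ (lshift _ (lshift _ (Ordinal a_gt0))) (lshift _ (lshift _ (Ordinal a_gt0))))/eqP.
  by rewrite !mxE eqxx eq_sym oner_eq0.
move: XM YN; rewrite XE YE ZE !mul_scalar_mx !mul_mx_scalar.
by split; apply: (scalerI x_neq0).
Qed.

End Intertwiner.

(** * Non-isomorphism and conclusion *)

Lemma normalized_rep_iso (F : fieldType) (charF0 : [pchar F] =i pred0) (n : nat)
    (n_gt0 : (0 < n)%N) (lambda : F) (lambda_neq0 : lambda != 0) (D D' : rep_data F n) :
  normalized D -> normalized D' -> rep_iso (R_rep lambda D) (R_rep lambda D') -> D = D'.
Proof.
move=> normD normD' /rep_iso_matrix[P [Q [PQ QP Prho]]].
have Px := Prho (g_x n lambda); have Pv := Prho (g_V lambda (bvec F (Ordinal n_gt0))).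
rewrite !R_rep_x in Px; rewrite !R_rep_v /R_v /= in Pv.
have Qx : Q *m R_x lambda D' = R_x lambda D *m Q.
  by rewrite -[R_x lambda D']mulmx1 -PQ !mulmxA -[Q *m _ *m P]mulmxA -Px mulmxA QP mul1mx.
case: D D' normD normD' P Q PQ QP Px Qx Pv {Prho}
  => [a b c a_gt0 b_gt0 c_gt0 condD M N M0 N0 alpha].
case=> [a' b' c' a_gt0' b_gt0' c_gt0' condD' M' N' M0' N0' alpha'].
rewrite /normalized /R_x /rep_dim /=.
move=> [rM rN cM] [rM' rN' cM'] P Q PQ QP Px Qx Pv.
(* [P] gives alpha' = alpha - i lambda and [Q] gives alpha = alpha' - j lambda, so i + j = 0. *)
have alphaE : alpha' = alpha.
  have [i _ e] := intertwiner_eig a_gt0' PQ Px; have [j _ e'] := intertwiner_eig a_gt0 QP Qx.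
  have : alpha - lambda *+ (i + j) = alpha - lambda *+ 0.
    by rewrite mulrnDr opprD addrA -e -e' mulr0n subr0.
  by move/(subr_mulrn_inj charF0 lambda_neq0)/eqP; rewrite addn_eq0 e => /andP[/eqP-> _]; rewrite subr0.
subst alpha'.
have [le_a le_b le_c] := intertwiner_dim charF0 lambda_neq0 PQ Px Qx.
have [ge_a ge_b ge_c] := intertwiner_dim charF0 lambda_neq0 QP Qx Px.
have [ea eb ec] : [/\ a' = a, b' = b & c' = c] by split; lia.
(* Only now do the matrices have the same types; the proof components are boolean equations and
   coincide. *)
subst a' b' c'.
have ea := bool_irrelevance a_gt0' a_gt0; have eb := bool_irrelevance b_gt0' b_gt0.
have ec := bool_irrelevance c_gt0' c_gt0; have econd := bool_irrelevance condD' condD.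
subst a_gt0' b_gt0' c_gt0' condD'.
have [eM eN] := normalized_intertwiner charF0 lambda_neq0 rM rM' rN rN' cM cM' PQ Px Pv.
subst M' N'.
by rewrite (bool_irrelevance M0' M0) (bool_irrelevance N0' N0).
Qed.

Theorem proposition3p4 (F : closedFieldType) (charF0 : [pchar F] =i pred0)
    (n : nat) (n_gt1 : (1 < n)%N) (lambda : F) (lambda_neq0 : lambda != 0) :
  (forall D D' : rep_data F n, normalized D -> normalized D' -> D <> D' ->
     ~ rep_iso (R_rep lambda D) (R_rep lambda D')) /\
  (forall D : rep_data F n, normalized D ->
     (relatively_faithful (R_rep lambda D) <-> ~ extreme_type D)).
Proof.
split=> [D D' normD normD' neq iso|D]; last exact: normalized_faithful.
exact: neq (normalized_rep_iso charF0 (ltnW n_gt1) lambda_neq0 normD normD' iso).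
Qed.
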